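(* In connective $K$-theory (setup below), for all $v,w\in W$: (1) $\psi^v(w)=\theta_w\,K^Y(v,w)$; (2) $\xi^v(w)=K^X(v,w)$.
   Context: Let $R=\mathbb Z[t]$ and $F(x,y)=x+y-txy$. Let $\Phi$ be a finite root system with weight lattice $\Lambda$, positive roots $\Phi^+$, negative roots $\Phi^-$, simple roots $\alpha_1,\dots,\alpha_n$, simple reflections $s_i$, Weyl group $W$ with length $\ell$, Bruhat order $\le$, longest element $w_\circ$. Let $S=R[[x_\lambda]]_{\lambda\in\Lambda}/(x_0,\;x_{\lambda+\nu}-F(x_\lambda,x_\nu))$ with $W$-action $w(x_\lambda)=x_{w\lambda}$, $Q$ its localization at all $x_\alpha$, $\alpha\in\Phi$, and $Q_W$ the twisted group algebra: free left $Q$-module on $\{\delta_w\}$ with $q\delta_w\cdot q'\delta_{w'}=q\,w(q')\,\delta_{ww'}$. Put $X_i=\frac1{x_{\alpha_i}}(\delta_{s_i}-1)$ and $Y_i=\frac1{x_{-\alpha_i}}+\frac1{x_{\alpha_i}}\delta_{s_i}$; they satisfy $Y_i^2=tY_i$, $X_i^2=-tX_i$ and the braid relations, so $X_v:=X_{i_1}\cdots X_{i_l}$ and $Y_v:=Y_{i_1}\cdots Y_{i_l}$ for a reduced word $(i_1,\dots,i_l)$ of $v$ are well defined, and $\{X_v\}$, $\{Y_v\}$ are left $Q$-bases of $Q_W$. Root polynomials: in $S\otimes_R Q_W$ (the left factor $S$, written in variables $y_\lambda$, commutes with $Q_W$), for $w\in W$ with reduced word $(i_1,\dots,i_l)$ and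 $\beta_k=s_{i_1}\cdots s_{i_{k-1}}\alpha_{i_k}$, set $\mathcal R^Y_w=\prod_{k=1}^l(1-y_{\beta_k}Y_{i_k})$ and $\mathcal R^X_w=\prod_{k=1}^l(1+y_{-\beta_k}X_{i_k})$ (ordered products; independent of the reduced word). Define $K^Y(v,w),K^X(v,w)\in S$ by $\mathcal R^Y_w=\sum_v K^Y(v,w)Y_v$ and $\mathcal R^X_w=\sum_vK^X(v,w)X_v$, and identify the left factor with $S$ via $y_\lambda\leftrightarrow x_\lambda$. Let $\theta_w=\prod_{\beta\in\Phi^+\cap w\Phi^-}\frac{1}{1-tx_\beta}\ (=\prod_{\beta}(-x_{-\beta}/x_\beta))$. GKM model: functions $f:W\to Q$ with $(X_if)(w)=\frac{f(ws_i)-f(w)}{x_{w\alpha_i}}$ and $(Y_if)(w)=\frac{f(w)}{x_{-w\alpha_i}}+\frac{f(ws_i)}{x_{w\alpha_i}}$. Let $\zeta_\emptyset(w)=\prod_{\alpha\in\Phi^+}x_{-\alpha}$ if $w=\mathrm{id}$, $0$ otherwise; for $u\in W$ with reduced word $(i_1,\dots,i_l)$ let $\widetilde\zeta_u=X_{i_l}\cdots X_{i_1}\zeta_\emptyset$ and $\zeta_u=Y_{i_l}\cdots Y_{i_1}\zeta_\emptyset$. Define $\psi^v(w):=\widetilde\zeta_{vw_\circ}(ww_\circ)$ and $\xi^v(w):=\zeta_{vw_\circ}(ww_\circ)$. *)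

(* Defs.v *)
From HB Require Import structures.
From mathcomp Require Import all_boot all_order all_algebra.
From Stdlib Require Import ClassicalEpsilon.
Set Implicit Arguments. Unset Strict Implicit. Unset Printing Implicit Defensive.
Import Order.TTheory GRing.Theory Num.Theory.
Local Open Scope ring_scope.

Definition pb (P : Prop) : bool :=
  if excluded_middle_informative P then true else false.

Section RootSystem.
Variable n : nat.
(* Weights are integer column vectors in the basis of fundamental weights,
   so Lambda = Z^n is the full weight lattice; Weyl group elements are
   integer matrices acting on Lambda by left multiplication. *)
Local Notation Mat := 'M[int]_n.
Local Notation Lam := 'cV[int]_n.

(* Generalized Cartan matrix, Kac convention C i j = <alpha_i^vee, alpha_j>. *)
Definition cartan (C : Mat) : Prop :=
  [/\ forall i, C i i = 2,
      forall i j, i != j -> C i j <= 0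
    & forall i j, (C i j == 0) = (C j i == 0)].

(* alpha_i written in fundamental weight coordinates *)
Definition simple_root (C : Mat) (i : 'I_n) : Lam := col i C.

(* s_i(lambda) = lambda - <lambda, alpha_i^vee> alpha_i *)
Definition sref (C : Mat) (i : 'I_n) : Mat :=
  \matrix_(j, k) ((j == k)%:R - C j i * (k == i)%:R).

Definition wordmx (C : Mat) (s : seq 'I_n) : Mat :=
  foldr (fun i M => sref C i *m M) 1%:M s.

Definition inW (C : Mat) (w : Mat) : Prop := exists s, w = wordmx C s.

Definition reduced (C : Mat) (s : seq 'I_n) : Prop :=
  forall s', wordmx C s' = wordmx C s -> (size s <= size s')%N.

Definition rword (C : Mat) (w : Mat) : seq 'I_n :=
  epsilon (inhabits [::]) (fun s => reduced C s /\ wordmx C s = w).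

Definition wlength (C : Mat) (w : Mat) : nat := size (rword C w).

Definition longest (C : Mat) (w0 : Mat) : Prop :=
  inW C w0 /\ forall w, inW C w -> (wlength C w <= wlength C w0)%N.

Definition is_root (C : Mat) (b : Lam) : Prop :=
  exists w i, inW C w /\ b = w *m simple_root C i.

(* positive root: nonnegative integer coefficients in the simple roots *)
Definition pos_root (C : Mat) (b : Lam) : Prop :=
  is_root C b /\ exists c : Lam, (forall i, 0 <= c i 0) /\ b = C *m c.

Definition neg_root (C : Mat) (b : Lam) : Prop := pos_root C (- b).

(* Wl is an enumeration of W (see the theorem) *)
Definition roots (C : Mat) (Wl : seq Mat) : seq Lam :=
  undup [seq w *m simple_root C i | w <- Wl, i <- enum 'I_n].

Definition posroots (C : Mat) (Wl : seq Mat) : seq Lam :=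
  [seq b <- roots C Wl | pb (pos_root C b)].

Definition betas (C : Mat) (s : seq 'I_n) : seq Lam :=
  map (fun p => wordmx C (take p.1 s) *m simple_root C p.2) (zip (iota 0 (size s)) s).

Fixpoint masks (l : nat) : seq bitseq :=
  if l is l'.+1 then [seq b :: m | b <- [:: false; true], m <- masks l']
  else [:: [::]].

Section Ring.
(* K plays the role of Q: a commutative ring, an algebra over R = Z[t]
   via t, with elements x_lambda and a W-action (see the hypotheses below). *)
Variables (K : comUnitRingType) (t : K) (x : Lam -> K) (act : Mat -> K -> K).

Definition fgl_ok : Prop :=
  x 0 = 0 /\ (forall l m, x (l + m) = x l + x m - t * x l * x m).

Definition act_ok (C : Mat) : Prop :=
  [/\ forall a, act 1%:M a = a,
      forall w w' a, inW C w -> inW C w' -> act (w *m w') a = act w (act w' a)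
    & forall w, inW C w ->
      [/\ forall a b, act w (a + b) = act w a + act w b,
          forall a b, act w (a * b) = act w a * act w b,
          act w 1 = 1, act w t = t
        & forall l, act w (x l) = x (w *m l)]].

Definition roots_invertible (C : Mat) : Prop :=
  forall a, is_root C a -> x a \is a GRing.unit.

(* Twisted group algebra Q_W: formal finite sums  sum q_k delta_{w_k},
   represented by lists of pairs (q_k, w_k); qcoef a u = coefficient of delta_u. *)
Definition QW := seq (K * Mat).
Definition qcoef (a : QW) (u : Mat) : K := \sum_(p <- a | p.2 == u) p.1.
Definition qmul (a b : QW) : QW :=
  [seq (p.1 * act p.2 q.1, p.2 *m q.2) | p <- a, q <- b].
Definition qscale (c : K) (a : QW) : QW := [seq (c * p.1, p.2) | p <- a].
Definition qone : QW := [:: (1, (1%:M : Mat))].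

Definition Xop (C : Mat) (i : 'I_n) : QW :=
  [:: ((x (simple_root C i))^-1, sref C i); (- (x (simple_root C i))^-1, (1%:M : Mat))].
Definition Yop (C : Mat) (i : 'I_n) : QW :=
  [:: ((x (- simple_root C i))^-1, (1%:M : Mat)); ((x (simple_root C i))^-1, sref C i)].

Definition Xword (C : Mat) (s : seq 'I_n) : QW := foldr (fun i a => qmul (Xop C i) a) qone s.
Definition Yword (C : Mat) (s : seq 'I_n) : QW := foldr (fun i a => qmul (Yop C i) a) qone s.

Definition Xbasis (C : Mat) (v : Mat) : QW := Xword C (rword C v).
Definition Ybasis (C : Mat) (v : Mat) : QW := Yword C (rword C v).

Definition coefs_in (B : Mat -> QW) (Wl : seq Mat) (a : QW) (c : Mat -> K) : Prop :=
  forall u, qcoef a u = qcoef (flatten [seq qscale (c v) (B v) | v <- undup Wl]) u.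

Definition bcoef (B : Mat -> QW) (Wl : seq Mat) (a : QW) : Mat -> K :=
  epsilon (inhabits (fun _ => 0)) (coefs_in B Wl a).

(* K^Y(v,w): coefficient of Y_v in R^Y_w = prod_k (1 - y_{beta_k} Y_{i_k}), the
   central left factor being expanded and then identified (y_lambda -> x_lambda). *)
Definition KY (C : Mat) (Wl : seq Mat) (v w : Mat) : K :=
  let s := rword C w in
  \sum_(m <- masks (size s))
     (\prod_(b <- mask m (betas C s)) (- x b)) * bcoef (Ybasis C) Wl (Yword C (mask m s)) v.

(* K^X(v,w): coefficient of X_v in R^X_w = prod_k (1 + y_{-beta_k} X_{i_k}) *)
Definition KX (C : Mat) (Wl : seq Mat) (v w : Mat) : K :=
  let s := rword C w in
  \sum_(m <- masks (size s))
     (\prod_(b <- mask m (betas C s)) x (- b)) * bcoef (Xbasis C) Wl (Xword C (mask m s)) v.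

Definition theta (C : Mat) (Wl : seq Mat) (w : Mat) : K :=
  \prod_(b <- posroots C Wl | pb (exists g, neg_root C g /\ b = w *m g))
     (1 - t * x b)^-1.

(* GKM model: functions W -> Q (defined on all matrices) *)
Definition GX (C : Mat) (i : 'I_n) (f : Mat -> K) : Mat -> K :=
  fun w => (f (w *m sref C i) - f w) * (x (w *m simple_root C i))^-1.
Definition GY (C : Mat) (i : 'I_n) (f : Mat -> K) : Mat -> K :=
  fun w => f w * (x (- (w *m simple_root C i)))^-1
         + f (w *m sref C i) * (x (w *m simple_root C i))^-1.

Definition zeta0 (C : Mat) (Wl : seq Mat) : Mat -> K :=
  fun w => if w == 1%:M then \prod_(a <- posroots C Wl) x (- a) else 0.

Definition zetaX (C : Mat) (Wl : seq Mat) (u : Mat) : Mat -> K :=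
  foldl (fun f i => GX C i f) (zeta0 C Wl) (rword C u).
Definition zetaY (C : Mat) (Wl : seq Mat) (u : Mat) : Mat -> K :=
  foldl (fun f i => GY C i f) (zeta0 C Wl) (rword C u).

Definition psi (C : Mat) (Wl : seq Mat) (w0 v w : Mat) : K :=
  zetaX C Wl (v *m w0) (w *m w0).
Definition xi (C : Mat) (Wl : seq Mat) (w0 v w : Mat) : K :=
  zetaY C Wl (v *m w0) (w *m w0).

End Ring.
End RootSystem.

(* Main.v *)
Require Import Defs.
From HB Require Import structures.
From mathcomp Require Import all_boot all_order all_algebra.
From mathcomp Require Import ring zify.
From Stdlib Require Import ClassicalEpsilon.
Set Implicit Arguments. Unset Strict Implicit. Unset Printing Implicit Defensive.
Import Order.TTheory GRing.Theory Num.Theory.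
Local Open Scope ring_scope.

(* Both sides satisfy the same recursion along right multiplication w -> w s_i.  Expanding the
   last factor of the root polynomial of a word (reduced or not) expresses K(v, w s_i) by K(v, w)
   and K(v s_i, w).  For the classes, let w0 alpha_j = - alpha_i, so that w0 s_j = s_i w0; if
   v s_i > v then v w0 s_j < v w0, and the class of v w0 is the operator of index j applied to
   the class of v s_i w0, which is the same relation.  At w = 1 both sides are delta_{v,1}: the
   class of w0 takes at w0 the value prod x_{-alpha} * prod x_{-alpha}^{-1} = 1.  The operators
   X_i and Y_i are the cases tau = 0 and tau = t of X_i + tau, and the classes built from
   X_i + tau correspond to the root polynomial built from X_i + (t - tau).

   The recursions need X_v and Y_v to be independent of the reduced word, that is, Matsumoto's
   theorem and the rank two braid relations.  With u_b = 1/x_b the formal group law becomes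
   u_{-b} = t - u_b and u_b u_c = u_{b+c} (u_b + u_c - t), and the braid relations are polynomial
   consequences of these.  Finiteness of W enters through the invariant form sum_w w^T w, which
   makes the Cartan matrix injective and bounds C i j * C j i by 3. *)

Lemma pbP (P : Prop) : reflect P (pb P).
Proof. by rewrite /pb; case: excluded_middle_informative => h; constructor. Qed.

Lemma size_masks k (m : bitseq) : m \in masks k -> size m = k.
Proof.
elim: k m => [|k IH] m /=; first by rewrite inE => /eqP->.
by rewrite mem_cat cats0 => /orP[] /mapP[m' /IH Em ->]; rewrite /= Em.
Qed.

Lemma big_masksS (V : nmodType) k (F : bitseq -> V) :
  \sum_(m <- masks k.+1) F m =
  \sum_(m <- masks k) F (false :: m) + \sum_(m <- masks k) F (true :: m).
Proof. by rewrite /= cats0 big_cat !big_map. Qed.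

Lemma big_masks_rcons (V : nmodType) k (F : bitseq -> V) :
  \sum_(m <- masks k.+1) F m =
  \sum_(m <- masks k) F (rcons m false) + \sum_(m <- masks k) F (rcons m true).
Proof.
elim: k F => [|k IH] F; first by rewrite big_masksS !big_seq1.
by rewrite big_masksS [X in _ = X + _]big_masksS [X in _ = _ + X]big_masksS !IH addrACA.
Qed.

Fixpoint altword (T : Type) (k : nat) (i j : T) : seq T :=
  if k is k'.+1 then rcons (altword k' j i) i else [::].

Lemma size_altword (T : Type) k (i j : T) : size (altword k i j) = k.
Proof. by elim: k i j => //= k IH i j; rewrite size_rcons IH. Qed.

Lemma altwordD (T : Type) k m (i j : T) :
  altword (k + m) i j = (if odd m then altword k j i else altword k i j) ++ altword m i j.
Proof.
elim: m i j => [|m IH] i j; first by rewrite addn0 cats0.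
by rewrite addnS /= IH rcons_cat if_neg.
Qed.

(* The possible values of - C i j and - C j i in a finite root system, up to exchanging i and j,
   with the order of s_i s_j. *)
Variant rank2_type : int -> int -> nat -> Prop :=
| TypeA1A1 : rank2_type 0 0 2
| TypeA2 : rank2_type 1 1 3
| TypeB2 : rank2_type 1 2 4
| TypeG2 : rank2_type 1 3 6.

(* Coordinates along alpha_i and alpha_j of the increment that altword k j i applies to
   l + a alpha_i + b alpha_j, where p = - C i j, q = - C j i, y = l_i and z = l_j. *)
Fixpoint rank2_coord (k : nat) (p q y z a b : int) : int * int :=
  if k is k'.+1 then
    let: (b', a') := rank2_coord k' q p z y (q * a - b - z) a in (a', b')
  else (a, b).

Lemma rank2_coord_ge0 k p q m : rank2_type p q m -> (k < m)%N ->
  [&& 0 <= (rank2_coord k p q 0 0 1 0).1, 0 <= (rank2_coord k p q 0 0 1 0).2,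
      0 <= (rank2_coord k q p 0 0 1 0).1 & 0 <= (rank2_coord k q p 0 0 1 0).2].
Proof. by case; do 7?[case: k => [|k] //=]. Qed.

Lemma rank2_coord_braid p q m y z : rank2_type p q m ->
  rank2_coord m p q y z 0 0 =
  ((rank2_coord m q p z y 0 0).2, (rank2_coord m q p z y 0 0).1).
Proof. by case=> /=; congr (_, _); lia. Qed.

(** * Words, length and descents *)

Section WeylGroup.
Variables (n : nat) (C : 'M[int]_n).
Implicit Types (i j : 'I_n) (k m : nat) (s r q : seq 'I_n) (w v y : 'M[int]_n) (l b c : 'cV[int]_n).
Local Notation s_ := (sref C).
Local Notation alpha := (simple_root C).
Local Notation word := (wordmx C).
Local Notation ell := (wlength C).
Local Notation W := (inW C).

Lemma simple_rootE i : alpha i = C *m delta_mx i 0.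
Proof. by rewrite /simple_root colE. Qed.

Lemma mulmx_sum_simple c : C *m c = \sum_i c i 0 *: alpha i.
Proof.
by apply/colP=> j; rewrite summxE mxE; apply: eq_bigr => i _; rewrite !mxE mulrC.
Qed.

Lemma eq_mulmx_col w v : (forall l, w *m l = v *m l) -> w = v.
Proof.
move=> eq_wv; apply/matrixP=> i j.
by have /colP/(_ i) := eq_wv (delta_mx j 0); rewrite -!colE !mxE.
Qed.

Lemma mulmx_sref i l : s_ i *m l = l - l i 0 *: alpha i.
Proof.
have -> : s_ i = 1%:M - alpha i *m delta_mx 0 i.
  apply/matrixP=> j k; rewrite !mxE (bigD1 ord0) //= big1 ?addr0; last first.
    by move=> o; rewrite ord1.
  by rewrite !mxE eqxx.
rewrite mulmxBl mul1mx -mulmxA -rowE; congr (_ - _).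
by apply/colP=> j; rewrite !mxE big_ord1 !mxE mulrC.
Qed.

Lemma wordmx_cat s r : word (s ++ r) = word s *m word r.
Proof. by elim: s => [|i s IH] /=; rewrite ?mul1mx // IH mulmxA. Qed.

Lemma wordmx_seq1 i : word [:: i] = s_ i.
Proof. exact: mulmx1. Qed.

Lemma wordmx_rcons s i : word (rcons s i) = word s *m s_ i.
Proof. by rewrite -cats1 wordmx_cat wordmx_seq1. Qed.

Lemma inW1 : W 1%:M. Proof. by exists [::]. Qed.

Lemma inW_word s : W (word s). Proof. by exists s. Qed.

Lemma inW_sref i : W (s_ i). Proof. by exists [:: i]; rewrite wordmx_seq1. Qed.

Lemma inW_mul w v : W w -> W v -> W (w *m v).
Proof. by case=> s -> [r ->]; rewrite -wordmx_cat; apply: inW_word. Qed.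

Lemma is_root_simple i : is_root C (alpha i).
Proof. by exists 1%:M, i; rewrite mul1mx; split=> //; apply: inW1. Qed.

Lemma is_root_mul w b : W w -> is_root C b -> is_root C (w *m b).
Proof.
by move=> Ww [v [i [Wv ->]]]; exists (w *m v), i; rewrite mulmxA; split=> //; apply: inW_mul.
Qed.

#[local] Hint Resolve inW1 inW_word inW_sref is_root_simple : core.
#[local] Hint Extern 0 (inW _ (_ *m _)) => solve [apply: inW_mul; done] : core.
#[local] Hint Extern 0 (is_root _ (_ *m _)) => solve [apply: is_root_mul; done] : core.

Lemma rword_spec w : W w -> reduced C (rword C w) /\ word (rword C w) = w.
Proof.
move=> [s0 Es0]; apply: (epsilon_spec (inhabits [::]) (fun s => reduced C s /\ word s = w)).
pose has_word k := pb (exists2 s, size s = k & word s = w).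
have ex_k : exists k, has_word k by exists (size s0); apply/pbP; exists s0.
case: (ex_minnP ex_k) => k /pbP[s Es Esw] min_k.
by exists s; split=> // r Er; rewrite Es; apply/min_k/pbP; exists r; rewrite ?Er.
Qed.

Lemma wordmx_rword w : W w -> word (rword C w) = w.
Proof. by case/rword_spec. Qed.

Lemma reduced_rword w : W w -> reduced C (rword C w).
Proof. by case/rword_spec. Qed.

Lemma wlength_word s : (ell (word s) <= size s)%N.
Proof. by apply: reduced_rword (inW_word s) _ _; rewrite wordmx_rword. Qed.

Lemma reducedP s : reduced C s <-> ell (word s) = size s.
Proof.
split=> [red_s | Es r Er]; last by rewrite -Es -Er wlength_word.
by apply/eqP; rewrite eqn_leq wlength_word red_s ?wordmx_rword.
Qed.

Lemma wlength1 : ell 1%:M = 0%N.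
Proof. by apply/eqP; rewrite -leqn0; apply: (wlength_word [::]). Qed.

Lemma wlength_mul_word w s : W w -> (ell (w *m word s) <= ell w + size s)%N.
Proof.
move=> Ww; rewrite -{1}(wordmx_rword Ww) -wordmx_cat.
by apply: leq_trans (wlength_word _) _; rewrite size_cat.
Qed.

Lemma wlength_mul_sref w i : W w -> (ell (w *m s_ i) <= (ell w).+1)%N.
Proof. by move=> Ww; rewrite -(wordmx_seq1 i) -addn1; apply: wlength_mul_word. Qed.

Lemma reduced_cat s r : reduced C (s ++ r) -> reduced C s.
Proof.
move=> red_sr q Eq; rewrite -(leq_add2r (size r)) -!size_cat.
by apply: red_sr; rewrite !wordmx_cat Eq.
Qed.

Lemma reduced_rcons s i : reduced C (rcons s i) -> reduced C s.
Proof. by rewrite -cats1; apply: reduced_cat. Qed.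

Lemma reduced_rword_cat v s : W v -> ell (v *m word s) = (ell v + size s)%N ->
  reduced C (rword C v ++ s).
Proof. by move=> Wv lvs; apply/reducedP; rewrite wordmx_cat wordmx_rword // size_cat. Qed.

Definition descent w i := (ell (w *m s_ i) < ell w)%N.

Section Cartan.
Hypothesis cartanC : cartan C.

Lemma cartan_diag i : C i i = 2. Proof. by case: cartanC. Qed.

Lemma cartan_le0 i j : i != j -> C i j <= 0.
Proof. by case: cartanC => _ C_le0 _; apply: C_le0. Qed.

Lemma simple_root_neq0 i : alpha i != 0.
Proof. by apply/eqP => /colP/(_ i); rewrite !mxE cartan_diag. Qed.

Lemma mulmx_sref_root i : s_ i *m alpha i = - alpha i.
Proof. by rewrite mulmx_sref mxE cartan_diag scaler_nat mulr2n opprD addNKr. Qed.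

Lemma mul_sref_root w i : w *m s_ i *m alpha i = - (w *m alpha i).
Proof. by rewrite -mulmxA mulmx_sref_root mulmxN. Qed.

Lemma sref2 i : s_ i *m s_ i = 1%:M.
Proof.
apply: eq_mulmx_col => l; rewrite -mulmxA mul1mx [s_ i *m l]mulmx_sref.
by rewrite mulmxBr -scalemxAr mulmx_sref_root mulmx_sref scalerN opprK subrK.
Qed.

Lemma srefK w i : w *m s_ i *m s_ i = w.
Proof. by rewrite -mulmxA sref2 mulmx1. Qed.

Lemma wordmx_mul_rev s : word s *m word (rev s) = 1%:M.
Proof.
elim/last_ind: s => [|s i IH]; first by rewrite mulmx1.
by rewrite rev_rcons wordmx_rcons /= mulmxA srefK.
Qed.

Lemma wordmx_rev_mul s : word (rev s) *m word s = 1%:M.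
Proof. by rewrite -{2}(revK s) wordmx_mul_rev. Qed.

Lemma inW_inv w : W w -> exists v, [/\ W v, v *m w = 1%:M & w *m v = 1%:M].
Proof.
by case=> s ->; exists (word (rev s)); rewrite wordmx_rev_mul wordmx_mul_rev.
Qed.

Lemma inW_mulIr w v y : W y -> v *m y = w *m y -> v = w.
Proof.
case/inW_inv => z [_ _ yz] /(congr1 (mulmx^~ z)).
by rewrite -!mulmxA yz !mulmx1.
Qed.

Lemma is_root_opp b : is_root C b -> is_root C (- b).
Proof. by case=> w [i [Ww ->]]; exists (w *m s_ i), i; rewrite mul_sref_root. Qed.

Lemma eq_wordmx_rev s r : word s = word r -> word (rev s) = word (rev r).
Proof. by move=> Esr; apply: (inW_mulIr (inW_word s)); rewrite {2}Esr !wordmx_rev_mul. Qed.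

Lemma reduced_rev s : reduced C s -> reduced C (rev s).
Proof.
move=> red_s r Er; rewrite size_rev -(size_rev r); apply: red_s.
by rewrite (eq_wordmx_rev Er) revK.
Qed.

Lemma wlength_inv w v : W w -> v *m w = 1%:M -> ell v = ell w.
Proof.
move=> Ww vw1; have -> : v = word (rev (rword C w)).
  by apply: (inW_mulIr Ww); rewrite -{3}(wordmx_rword Ww) wordmx_rev_mul.
by have /reducedP -> := reduced_rev (reduced_rword Ww); rewrite size_rev.
Qed.

Lemma wlength_descent w i : W w -> descent w i -> ell w = (ell (w *m s_ i)).+1.
Proof.
move=> Ww desc_i; apply/anti_leq/andP; split=> //.
by rewrite -{1}(srefK w i) wlength_mul_sref.
Qed.

Lemma ascent_mul_sref w i : descent w i -> ~~ descent (w *m s_ i) i.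
Proof. by rewrite /descent srefK -leqNgt => /ltnW. Qed.

Lemma reduced_rcons_ascent s i : reduced C (rcons s i) -> ~~ descent (word s) i.
Proof.
move=> red_si; rewrite /descent -wordmx_rcons -leqNgt.
have /reducedP -> := red_si; have /reducedP -> := reduced_rcons red_si.
by rewrite size_rcons.
Qed.

Lemma reduced_rcons_descent s i : reduced C (rcons s i) -> descent (word (rcons s i)) i.
Proof.
move=> red_si; rewrite /descent {1}wordmx_rcons srefK.
have /reducedP -> := red_si; have /reducedP -> := reduced_rcons red_si.
by rewrite size_rcons.
Qed.

Lemma exists_descent w : W w -> w != 1%:M -> exists i, descent w i.
Proof.
move=> Ww; have [] := rword_spec Ww; case/lastP: (rword C w) => [_ <- /eqP //|s i].
by move=> /reduced_rcons_descent desc_i <- _; exists i.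
Qed.

(** * The invariant form *)

Section FiniteType.
Variable Wl : seq 'M[int]_n.
Hypothesis enumW : forall w, W w <-> w \in Wl.

Lemma mem_undupW w : (w \in undup Wl) = pb (W w).
Proof. by rewrite mem_undup; apply/idP/pbP => /enumW. Qed.

Lemma perm_mulr_undupW v : W v -> perm_eq [seq w *m v | w <- undup Wl] (undup Wl).
Proof.
move=> Wv; have [v' [Wv' v'v vv']] := inW_inv Wv.
have mulIv : injective (fun w => w *m v) by move=> w y; apply: inW_mulIr.
apply: uniq_perm; rewrite ?map_inj_uniq ?undup_uniq // => w.
rewrite mem_undupW; apply/mapP/pbP => [[y]|Ww].
  by rewrite mem_undupW => /pbP Wy ->.
exists (w *m v'); last by rewrite -mulmxA v'v mulmx1.
by rewrite mem_undupW; apply/pbP.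
Qed.

Definition weyl_gram : 'M[int]_n := \sum_(w <- undup Wl) w^T *m w.
Definition weyl_form l b : int := (l^T *m weyl_gram *m b) 0 0.
Local Notation "''[' l , b ]" := (weyl_form l b).

Lemma weyl_formE l b : '[l, b] = \sum_(w <- undup Wl) \sum_i (w *m l) i 0 * (w *m b) i 0.
Proof.
rewrite /weyl_form /weyl_gram mulmx_sumr mulmx_suml summxE; apply: eq_bigr => w _.
by rewrite mulmxA -trmx_mul -mulmxA mxE; apply: eq_bigr => i _; rewrite mxE.
Qed.

Lemma weyl_formC l b : '[l, b] = '[b, l].
Proof.
by rewrite !weyl_formE; do 2!apply: eq_bigr => ? _; rewrite mulrC.
Qed.

Lemma weyl_formNr l b : '[l, - b] = - '[l, b].
Proof. by rewrite /weyl_form mulmxN mxE. Qed.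

Lemma weyl_formDr l b c : '[l, b + c] = '[l, b] + '[l, c].
Proof. by rewrite /weyl_form mulmxDr mxE. Qed.

Lemma weyl_formZr l a b : '[l, a *: b] = a * '[l, b].
Proof. by rewrite /weyl_form -scalemxAr mxE. Qed.

Lemma weyl_formNl l b : '[- l, b] = - '[l, b].
Proof. by rewrite weyl_formC weyl_formNr weyl_formC. Qed.

Lemma weyl_formDl l b c : '[l + b, c] = '[l, c] + '[b, c].
Proof. by rewrite weyl_formC weyl_formDr !(weyl_formC c). Qed.

Lemma weyl_formZl a l b : '[a *: l, b] = a * '[l, b].
Proof. by rewrite weyl_formC weyl_formZr weyl_formC. Qed.

Lemma weyl_form_sumr l (I : finType) (F : I -> 'cV_n) : '[l, \sum_i F i] = \sum_i '[l, F i].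
Proof. by rewrite /weyl_form mulmx_sumr summxE. Qed.

Lemma weyl_form_mul v l b : W v -> '[v *m l, v *m b] = '[l, b].
Proof.
move=> Wv; rewrite !weyl_formE -[RHS](perm_big _ (perm_mulr_undupW Wv)) big_map.
by apply: eq_bigr => w _; rewrite !mulmxA.
Qed.

Lemma weyl_form_gt0 l : l != 0 -> 0 < '[l, l].
Proof.
move=> l_neq0; have sq_ge0 w : 0 <= \sum_i (w *m l) i 0 * (w *m l) i 0.
  by apply: sumr_ge0 => i _; rewrite -expr2 sqr_ge0.
have W1 : 1%:M \in undup Wl by rewrite mem_undupW; apply/pbP.
rewrite weyl_formE (bigD1_seq 1%:M) ?undup_uniq //= ltr_wpDr ?sumr_ge0 //.
rewrite lt_def sq_ge0 andbT; apply: contra l_neq0; rewrite psumr_eq0 => [/allP l0|i _].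
  apply/eqP/colP => i; have := l0 i (mem_index_enum i).
  by rewrite mul1mx mulf_eq0 orbb mxE => /eqP.
by rewrite -expr2 sqr_ge0.
Qed.

Lemma weyl_form_root_gt0 i : 0 < '[alpha i, alpha i].
Proof. exact/weyl_form_gt0/simple_root_neq0. Qed.

Lemma weyl_form_simple l i : 2 * '[l, alpha i] = l i 0 * '[alpha i, alpha i].
Proof.
have := weyl_form_mul l (alpha i) (inW_sref i).
rewrite mulmx_sref_root mulmx_sref weyl_formNr weyl_formDl weyl_formNl weyl_formZl => E.
by rewrite mulr_natl mulr2n -{1}E; ring.
Qed.

Lemma weyl_form_simple_le0 i j : i != j -> '[alpha i, alpha j] <= 0.
Proof.
move=> neq_ij; rewrite -(pmulr_rle0 _ (_ : 0 < 2)) // weyl_form_simple.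
by rewrite pmulr_lle0 ?weyl_form_root_gt0 // mxE cartan_le0 // eq_sym.
Qed.

Lemma cartan_ge0_inj c : (forall i, 0 <= c i 0) -> C *m c = 0 -> c = 0.
Proof.
move=> c_ge0 Cc0; pose rho : 'cV[int]_n := const_mx 1.
have : \sum_i c i 0 * '[alpha i, alpha i] = 0.
  transitivity (2 * '[rho, C *m c]); last by rewrite Cc0 /weyl_form mulmx0 mxE mulr0.
  rewrite mulmx_sum_simple weyl_form_sumr mulr_sumr; apply: eq_bigr => i _.
  by rewrite weyl_formZr mulrCA weyl_form_simple mxE mul1r.
move/eqP; rewrite psumr_eq0 => [/allP c0|i _]; last first.
  by rewrite mulr_ge0 // ltW ?weyl_form_root_gt0.
apply/colP => i; have := c0 i (mem_index_enum i).
by rewrite mulf_eq0 (gt_eqF (weyl_form_root_gt0 i)) orbF mxE => /eqP.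
Qed.

(* Distinct simple roots pair nonpositively, so replacing a kernel vector by its
   entrywise absolute value cannot increase the norm of its image. *)
Lemma cartan_inj c : C *m c = 0 -> c = 0.
Proof.
move=> Cc0; pose d : 'cV[int]_n := \col_i `|c i 0|.
suff Cd0 : C *m d = 0.
  have d0 : d = 0 by apply: cartan_ge0_inj Cd0 => i; rewrite mxE.
  by apply/colP=> i; have /colP/(_ i)/eqP := d0; rewrite !mxE normr_eq0 => /eqP.
have normE (z : 'cV_n) :
    '[C *m z, C *m z] = \sum_i \sum_j z i 0 * z j 0 * '[alpha i, alpha j].
  rewrite {2}mulmx_sum_simple weyl_form_sumr; apply: eq_bigr => i _.
  rewrite weyl_formZr weyl_formC mulmx_sum_simple weyl_form_sumr mulr_sumr.
  by apply: eq_bigr => j _; rewrite weyl_formZr mulrA.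
apply/eqP/negPn/negP => /weyl_form_gt0; apply/negP; rewrite -leNgt.
have <- : '[C *m c, C *m c] = 0 by rewrite Cc0 /weyl_form mulmx0 mxE.
rewrite !normE; apply: ler_sum => i _; apply: ler_sum => j _; rewrite !mxE -normrM.
have [->|neq_ij] := eqVneq i j; first by rewrite ger0_norm // -expr2 sqr_ge0.
by rewrite ler_wnM2r ?weyl_form_simple_le0 ?ler_norm.
Qed.

Lemma cartan_mul_lt4 i j : i != j -> C i j * C j i < 4.
Proof.
move=> neq_ij; pose c : 'cV[int]_n := 2 *: delta_mx j 0 - C i j *: delta_mx i 0.
have : C *m c != 0.
  apply/eqP => /cartan_inj/colP/(_ j).
  by rewrite !mxE !eqxx eq_sym (negPf neq_ij) mulr0 subr0.
have -> : C *m c = 2 *: alpha j + (- C i j) *: alpha i.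
  by rewrite !simple_rootE !scalemxAr -mulmxDr scaleNr.
have := weyl_form_simple (alpha i) j; have := weyl_form_simple (alpha j) i.
have := weyl_form_root_gt0 j; rewrite !mxE ['[alpha i, alpha j]]weyl_formC.
set gj := '[alpha j, alpha j] => gj_gt0 Ei Ej /weyl_form_gt0.
rewrite !weyl_formDl !weyl_formDr !weyl_formZl !weyl_formZr ['[alpha i, alpha j]]weyl_formC -/gj.
set f := '[alpha j, alpha i] in Ei Ej *; set gi := '[alpha i, alpha i] in Ei *.
suff -> : 2 * (2 * gj) + 2 * (- C i j * f) + (- C i j * (2 * f) + - C i j * (- C i j * gi)) =
    (4 - C i j * C j i) * gj by rewrite pmulr_lgt0 // subr_gt0.
transitivity (4 * gj - 2 * C i j * (2 * f) + C i j * (C i j * gi)); first by ring.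
by rewrite -Ei Ej; ring.
Qed.

(** * Positivity of roots *)

Definition braid_order i j m :=
  rank2_type (- C i j) (- C j i) m \/ rank2_type (- C j i) (- C i j) m.

Lemma braid_order_sym i j m : braid_order i j m -> braid_order j i m.
Proof. by case; [right | left]. Qed.

Lemma braid_order_gt0 i j m : braid_order i j m -> (0 < m)%N.
Proof. by case; case. Qed.

Lemma braid_order_exists i j : i != j -> exists m, braid_order i j m.
Proof.
move=> neq_ij; have neq_ji : j != i by rewrite eq_sym.
have := cartan_mul_lt4 neq_ij; have := cartan_le0 neq_ij; have := cartan_le0 neq_ji.
have [_ _ /(_ i j)] := cartanC; rewrite /braid_order.
move: (C i j) (C j i) => a b ab0 b_le0 a_le0 ab_lt4.
have [a0|a_neq0] := eqVneq a 0.
  by move: ab0; rewrite a0 eqxx => /esym/eqP ->; exists 2%N; left; constructor.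
have b_neq0 : b != 0 by rewrite -ab0.
have [a_eq|b_eq] : a = -1 \/ b = -1 by nia.
- have [->|[->|->]] : b = -1 \/ b = -2 \/ b = -3 by nia.
  + by exists 3%N; left; rewrite a_eq; constructor.
  + by exists 4%N; left; rewrite a_eq; constructor.
  + by exists 6%N; left; rewrite a_eq; constructor.
have [->|[->|->]] : a = -1 \/ a = -2 \/ a = -3 by nia.
+ by exists 3%N; left; rewrite b_eq; constructor.
+ by exists 4%N; right; rewrite b_eq; constructor.
by exists 6%N; right; rewrite b_eq; constructor.
Qed.

Definition simple_comb i j (a b : int) := a *: alpha i + b *: alpha j.

Lemma simple_combC i j (a b : int) : simple_comb i j a b = simple_comb j i b a.
Proof. exact: addrC. Qed.

Lemma simple_comb00 i j : simple_comb i j 0 0 = 0.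
Proof. by rewrite /simple_comb !scale0r addr0. Qed.

Lemma simple_comb10 i j : simple_comb i j 1 0 = alpha i.
Proof. by rewrite /simple_comb scale1r scale0r addr0. Qed.

Lemma simple_comb01 i j : simple_comb i j 0 1 = alpha j.
Proof. by rewrite simple_combC simple_comb10. Qed.

Lemma sref_simple_comb i j (a b : int) :
  s_ i *m simple_comb i j a b = simple_comb i j (- C i j * b - a) b.
Proof.
rewrite mulmxDr -!scalemxAr mulmx_sref_root mulmx_sref.
by apply/colP=> k; rewrite !mxE; ring.
Qed.

Lemma word_altword k i j l (a b : int) :
  let ab := rank2_coord k (- C i j) (- C j i) (l i 0) (l j 0) a b in
  word (altword k j i) *m (l + simple_comb i j a b) = l + simple_comb i j ab.1 ab.2.
Proof.
elim: k i j a b => [|k IH] i j a b /=; first by rewrite mul1mx.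
rewrite wordmx_rcons -mulmxA mulmxDr simple_combC sref_simple_comb mulmx_sref.
have -> : l - l j 0 *: alpha j + simple_comb j i (- C j i * a - b) a =
    l + simple_comb j i (- C j i * a - b - l j 0) a.
  by apply/colP=> m; rewrite !mxE; ring.
by rewrite IH; case: (rank2_coord _ _ _ _ _ _ _) => b' a'; rewrite /= simple_combC.
Qed.

Lemma word_braid i j m : braid_order i j m -> word (altword m i j) = word (altword m j i).
Proof.
suff braid i' j' : rank2_type (- C i' j') (- C j' i') m ->
    word (altword m i' j') = word (altword m j' i').
  by case=> /braid.
move=> type_m; apply: eq_mulmx_col => l; rewrite -[l]addr0 -(simple_comb00 i' j').
rewrite [RHS]word_altword (rank2_coord_braid _ _ type_m).
by rewrite simple_combC word_altword simple_combC.
Qed.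

Definition cone b := exists c : 'cV[int]_n, (forall i, 0 <= c i 0) /\ b = C *m c.

Lemma cone0 : cone 0.
Proof. by exists 0; split=> [i|]; rewrite ?mxE ?mulmx0. Qed.

Lemma coneD b c : cone b -> cone c -> cone (b + c).
Proof.
move=> [d [d_ge0 ->]] [e [e_ge0 ->]]; exists (d + e); rewrite mulmxDr.
by split=> // i; rewrite mxE addr_ge0.
Qed.

Lemma coneZ (a : int) b : 0 <= a -> cone b -> cone (a *: b).
Proof.
move=> a_ge0 [c [c_ge0 ->]]; exists (a *: c); rewrite scalemxAr.
by split=> // i; rewrite mxE mulr_ge0.
Qed.

Lemma cone_simple i : cone (alpha i).
Proof. by exists (delta_mx i 0); rewrite simple_rootE; split=> // j; rewrite mxE. Qed.

Lemma cone_opp b : cone b -> cone (- b) -> b = 0.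
Proof.
move=> [c [c_ge0 Eb]] [d [d_ge0 ENb]].
have cd0 : c + d = 0 by apply: cartan_inj; rewrite mulmxDr -Eb -ENb subrr.
rewrite Eb (_ : c = 0) ?mulmx0 //; apply/colP=> i.
by have /colP/(_ i)/eqP := cd0; rewrite !mxE paddr_eq0 // => /andP[/eqP].
Qed.

Lemma cone_simple_extremal i (m : int) b c : cone b -> cone c -> b + c = m *: alpha i ->
  exists2 a : int, 0 <= a & b = a *: alpha i.
Proof.
move=> [d [d_ge0 ->]] [e [e_ge0 ->]]; rewrite simple_rootE scalemxAr -mulmxDr => /eqP.
rewrite -subr_eq0 -mulmxBr => /eqP/cartan_inj/eqP; rewrite subr_eq0 => /eqP/colP de.
exists (d i 0) => //; rewrite scalemxAr; congr (_ *m _); apply/colP => j; rewrite !mxE eqxx andbT.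
have [->|neq_ji] := eqVneq j i; first by rewrite mulr1.
have /eqP := de j; rewrite !mxE (negPf neq_ji) mulr0 paddr_eq0 // => /andP[/eqP -> _].
by rewrite mulr0.
Qed.

Lemma cone_mul w b : (forall i, cone (w *m alpha i)) -> cone b -> cone (w *m b).
Proof.
move=> cone_w [c [c_ge0 ->]]; rewrite mulmx_sum_simple mulmx_sumr.
apply: big_ind => [|b' c'|i _]; [exact: cone0 | exact: coneD |].
by rewrite -scalemxAr; apply: coneZ.
Qed.

Lemma cone_altword i j m k v : braid_order i j m -> (k < m)%N ->
  cone (v *m alpha i) -> cone (v *m alpha j) -> cone (v *m word (altword k j i) *m alpha i).
Proof.
move=> ord_m lt_km cone_i cone_j; rewrite -mulmxA -(simple_comb10 i j) -[simple_comb _ _ _ _]add0r.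
rewrite word_altword add0r mulmxDr -!scalemxAr !mxE.
by case: ord_m => /rank2_coord_ge0/(_ lt_km)/and4P[? ? ? ?]; apply: coneD; apply: coneZ.
Qed.

Lemma descent_altword k i j v : W v ->
  ell (v *m word (altword k.+1 i j)) = (ell v + k.+1)%N ->
  descent (v *m word (altword k.+1 i j)) i.
Proof.
move=> Wv E; rewrite /descent E /= wordmx_rcons mulmxA srefK // addnS ltnS.
by apply: leq_trans (wlength_mul_word _ Wv) _; rewrite size_altword.
Qed.

Definition dihedral_decomp i j w v k :=
  [/\ W v, ~~ descent v i && ~~ descent v j, ell w = (ell v + k)%N
    & w = v *m word (altword k i j) \/ w = v *m word (altword k j i)].

Lemma dihedral_decompC i j w v k : dihedral_decomp i j w v k -> dihedral_decomp j i w v k.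
Proof. by case=> Wv asc_v lw Ew; split; rewrite 1?andbC //; case: Ew; [right | left]. Qed.

Lemma dihedral_decomp_exists i j w : W w -> exists v k, dihedral_decomp i j w v k.
Proof.
move: {2}(ell w).+1 (ltnSn (ell w)) => N; elim: N w i j => // N IH w i j lt_wN Ww.
suff extend i' j' : descent w i' -> exists v k, dihedral_decomp i' j' w v k.
  have [/extend //|asc_i] := boolP (descent w i).
  have [/(extend j i)[v [k /dihedral_decompC]]|asc_j] := boolP (descent w j); first by exists v, k.
  by exists w, 0%N; rewrite /dihedral_decomp asc_i asc_j addn0 mulmx1; split=> //; left.
move=> desc_i; have lw := wlength_descent Ww desc_i.
have [|//|v [k [Wv asc_v lwi Ewi]]] := IH (w *m s_ i') i' j'; first by rewrite lw in lt_wN.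
suff Ewi' : w *m s_ i' = v *m word (altword k j' i').
  exists v, k.+1; split=> //; first by rewrite lw lwi addnS.
  by left; rewrite /= wordmx_rcons mulmxA -Ewi' srefK.
case: Ewi => // Ewi; case: k => // k in lwi Ewi *.
by case/negP: (ascent_mul_sref desc_i); rewrite Ewi descent_altword // -Ewi.
Qed.

Lemma dihedral_factor i j m v k : braid_order i j m -> W v -> (m <= k)%N ->
  ell (v *m word (altword k i j)) = (ell v + k)%N ->
  exists y, [/\ W y, v *m word (altword k i j) = y *m word (altword m i j)
              & ell (y *m word (altword m i j)) = (ell y + m)%N].
Proof.
move=> ord_m Wv le_mk; rewrite -(subnK le_mk) altwordD wordmx_cat mulmxA.
set r := if _ then _ else _; set d := (k - m)%N => E; exists (v *m word r); split=> //.
have size_r : size r = d by rewrite /r; case: ifP; rewrite size_altword.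
have Wy : W (v *m word r) by [].
apply/anti_leq; rewrite E.
have := wlength_mul_word r Wv; have := wlength_mul_word (altword m i j) Wy.
by rewrite E size_r size_altword; lia.
Qed.

Lemma cone_ascent w i : W w -> ~~ descent w i -> cone (w *m alpha i).
Proof.
move: {2}(ell w).+1 (ltnSn (ell w)) => N; elim: N w i => // N IH w i lt_wN Ww asc_i.
have [->|w_neq1] := eqVneq w 1%:M; first by rewrite mul1mx; apply: cone_simple.
have [j desc_j] := exists_descent Ww w_neq1.
have neq_ij : i != j by apply: contraNneq asc_i => ->.
have [m ord_m] := braid_order_exists neq_ij.
have [v [[|k] [Wv /andP[asc_vi asc_vj] lw Ew]]] := dihedral_decomp_exists i j Ww.
  by case/negP: asc_vj; case: Ew desc_j => ->; rewrite mulmx1.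
case: Ew => Ew; first by case/negP: asc_i; rewrite Ew descent_altword // -Ew.
have [le_mk|lt_km] := leqP m k.+1.
  have [|y [Wy Ey ly]] := dihedral_factor (braid_order_sym ord_m) Wv le_mk; first by rewrite -Ew.
  case/negP: asc_i; rewrite Ew Ey.
  rewrite -(word_braid ord_m) -(prednK (braid_order_gt0 ord_m)) in ly *.
  exact: descent_altword.
have lt_vN : (ell v < N)%N by move: lw lt_wN; lia.
by rewrite Ew; apply: cone_altword ord_m lt_km _ _; apply: IH.
Qed.

Lemma mul_root_neq0 w i : W w -> w *m alpha i != 0.
Proof.
move=> Ww; have [v [_ vw _]] := inW_inv Ww.
apply: contraNneq (simple_root_neq0 i) => /(congr1 (mulmx v)).
by rewrite mulmxA vw mul1mx mulmx0 => ->.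
Qed.

Lemma cone_descent w i : W w -> descent w i = pb (cone (- (w *m alpha i))).
Proof.
move=> Ww; apply/idP/pbP => [desc_i|neg_i].
  rewrite -mul_sref_root //; apply: cone_ascent => //.
  exact: ascent_mul_sref.
apply: contraLR (mul_root_neq0 i Ww) => /(cone_ascent Ww)/cone_opp/(_ neg_i) ->.
by rewrite eqxx.
Qed.

Lemma wlength_ascent w i : W w -> ~~ descent w i -> ell (w *m s_ i) = (ell w).+1.
Proof.
move=> Ww asc_i; have desc_i : descent (w *m s_ i) i.
  by rewrite cone_descent // mul_sref_root // opprK; apply/pbP/cone_ascent.
by rewrite (wlength_descent _ desc_i) // srefK.
Qed.

Lemma descent_mul_sref w i : W w -> descent (w *m s_ i) i = ~~ descent w i.
Proof.
move=> Ww; apply/idP/idP => [desc_i|asc_i]; last by rewrite /descent srefK wlength_ascent.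
by have := ascent_mul_sref desc_i; rewrite srefK.
Qed.

Lemma reduced_rword_rcons w i : W w -> ~~ descent w i -> reduced C (rcons (rword C w) i).
Proof.
move=> Ww asc_i; rewrite -cats1; apply: reduced_rword_cat => //.
by rewrite wordmx_seq1 wlength_ascent // addn1.
Qed.

(** * Matsumoto's theorem *)

Lemma two_descents i j m w : braid_order i j m -> W w -> descent w i -> descent w j ->
  exists y, [/\ W y, w = y *m word (altword m i j) & ell w = (ell y + m)%N].
Proof.
move=> ord_m Ww desc_i desc_j.
have [v [k [Wv asc_v lw Ew]]] := dihedral_decomp_exists i j Ww.
suff long i' j' : braid_order i' j' m -> ~~ descent v i' && ~~ descent v j' -> descent w j' ->
    w = v *m word (altword k i' j') ->
    exists y, [/\ W y, w = y *m word (altword m i' j') & ell w = (ell y + m)%N].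
  case: Ew => Ew; first exact: long Ew.
  by rewrite (word_braid ord_m); apply: long Ew; rewrite 1?andbC //; apply: braid_order_sym.
move=> ord_m' /andP[asc_i' asc_j'] desc_j' Ew'.
have [le_mk|lt_km] := leqP m k.
  have [|y [Wy Ey ly]] := dihedral_factor ord_m' Wv le_mk; first by rewrite -Ew'.
  by exists y; rewrite Ew' Ey.
have := cone_altword (braid_order_sym ord_m') lt_km (cone_ascent Wv asc_j') (cone_ascent Wv asc_i').
rewrite -Ew' => pos_j'; move: desc_j'; rewrite cone_descent // => /pbP/(cone_opp pos_j')/eqP.
by rewrite (negPf (mul_root_neq0 _ Ww)).
Qed.

Lemma matsumoto (T : Type) (F : seq 'I_n -> T) :
  (forall q r i j m, braid_order i j m ->
     F (q ++ altword m i j ++ r) = F (q ++ altword m j i ++ r)) ->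
  forall s r, reduced C s -> reduced C r -> word s = word r -> F s = F r.
Proof.
move=> braidF s; move: {2}(size s).+1 (ltnSn (size s)) => N.
elim: N F braidF s => // N IH F braidF s lt_sN r red_s red_r Esr.
have same_last q q' i : (size q < N)%N -> reduced C (rcons q i) -> reduced C (rcons q' i) ->
    word (rcons q i) = word (rcons q' i) -> F (rcons q i) = F (rcons q' i).
  move=> lt_qN /reduced_rcons red_q /reduced_rcons red_q'; rewrite !wordmx_rcons.
  move/(inW_mulIr (inW_sref i)); apply: (IH (fun s => F (rcons s i))) => // q1 q2 i1 j1 m.
  by move/braidF => braid1; rewrite !rcons_cat braid1.
have size_sr : size s = size r by apply/eqP; rewrite eqn_leq red_s ?red_r.
case/lastP: s => [|s i] in lt_sN red_s Esr size_sr *.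
  by rewrite (size0nil (esym size_sr)).
case/lastP: r => [|r j] in red_r Esr size_sr *; first by rewrite size_rcons in size_sr.
move: lt_sN size_sr; rewrite !size_rcons => lt_sN [size_sr].
have [Eij|neq_ij] := eqVneq i j; first by rewrite -Eij in red_r Esr *; apply: same_last.
have [[|m] ord_m] := braid_order_exists neq_ij; first by have := braid_order_gt0 ord_m.
have desc_j : descent (word (rcons s i)) j by rewrite Esr reduced_rcons_descent.
have [y [Wy Ey ly]] := two_descents ord_m (inW_word _) (reduced_rcons_descent red_s) desc_j.
have Em := word_braid ord_m; have := braidF (rword C y) [::] _ _ _ ord_m.
have := @reduced_rword_cat y (altword m.+1 i j) Wy.
have := @reduced_rword_cat y (altword m.+1 j i) Wy.
rewrite !size_altword -Em -Ey ly !cats0 /= -!rcons_cat => /(_ erefl) red_j /(_ erefl) red_i braid_y.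
rewrite (same_last s _ i _ red_s red_i) //; last first.
  by rewrite rcons_cat wordmx_cat wordmx_rword // [RHS]Ey.
rewrite braid_y -(same_last r _ j _ red_r red_j) -?size_sr //.
by rewrite -Esr rcons_cat wordmx_cat wordmx_rword // Ey Em.
Qed.

(** * Roots and inversions *)

Lemma root_lattice b : is_root C b -> exists c, b = C *m c.
Proof.
case=> w [i [[s ->] ->]]; elim: s => [|j s [c Ec]].
  by exists (delta_mx i 0); rewrite mul1mx simple_rootE.
exists (c - (C *m c) j 0 *: delta_mx j 0).
by rewrite /= -mulmxA Ec mulmx_sref simple_rootE scalemxAr -mulmxBr.
Qed.

Lemma root_primitive (a : int) b : is_root C (a *: b) -> is_root C b -> a \is a GRing.unit.
Proof.
case=> w [i [Ww Eab]] Rb; have [v [Wv vw _]] := inW_inv Ww.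
have [c Ec] := root_lattice (is_root_mul Wv Rb).
apply/unitrPr; exists (c i 0).
have : C *m (a *: c - delta_mx i 0) = 0.
  by rewrite mulmxBr -scalemxAr -Ec scalemxAr Eab mulmxA vw mul1mx -simple_rootE subrr.
by move/cartan_inj/colP/(_ i)/eqP; rewrite !mxE !eqxx subr_eq0 => /eqP.
Qed.

Lemma root_scale_simple (a : int) i : is_root C (a *: alpha i) -> 0 <= a -> a = 1.
Proof. by case/root_primitive/(_ (is_root_simple i))/orP => /eqP ->. Qed.

Lemma pos_root_simple i : pos_root C (alpha i).
Proof. by split; [apply: is_root_simple | apply: cone_simple]. Qed.

Lemma pos_root_ascent w i : W w -> ~~ descent w i -> pos_root C (w *m alpha i).
Proof. by move=> Ww asc_i; split; [| apply: cone_ascent]. Qed.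

Lemma pos_or_neg_root b : is_root C b -> pos_root C b \/ neg_root C b.
Proof.
move=> Rb; have RNb := is_root_opp Rb; have [w [i [Ww Eb]]] := Rb.
have [desc_i|asc_i] := boolP (descent w i); last by left; rewrite Eb; apply: pos_root_ascent.
by right; split=> //; rewrite Eb; apply/pbP; rewrite -cone_descent.
Qed.

Lemma pos_root_not_neg b : pos_root C b -> ~ neg_root C b.
Proof.
move=> [[w [i [Ww ->]]] pos_b] [_ /(cone_opp pos_b)/eqP].
by rewrite (negPf (mul_root_neq0 i Ww)).
Qed.

Lemma sref_pos_root i b : pos_root C b -> b = alpha i \/ pos_root C (s_ i *m b).
Proof.
move=> [Rb pos_b]; have [|[_ neg_sb]] := pos_or_neg_root (is_root_mul (inW_sref i) Rb).
  by right.
left; have [|a a_ge0 Eb] := cone_simple_extremal (m := b i 0) (i := i) pos_b neg_sb.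
  by rewrite mulmx_sref opprB addrC subrK.
by rewrite Eb (@root_scale_simple a i) ?scale1r // -Eb.
Qed.

Lemma betas_rcons s i : betas C (rcons s i) = rcons (betas C s) (word s *m alpha i).
Proof.
rewrite /betas size_rcons -[(size s).+1]addn1 iotaD add0n cats1 zip_rcons ?size_iota //.
rewrite map_rcons /=.
congr rcons; last by rewrite -cats1 take_size_cat.
apply/eq_in_map => -[k j] /(map_f fst); rewrite /= -/unzip1 unzip1_zip ?size_iota //.
by rewrite mem_iota => /andP[_ lt_k]; rewrite -cats1 takel_cat // ltnW.
Qed.

Lemma betas_cons i s : betas C (i :: s) = alpha i :: [seq s_ i *m b | b <- betas C s].
Proof.
elim/last_ind: s => [|s j IH]; first by rewrite /betas /= mul1mx.
by rewrite -rcons_cons !betas_rcons IH map_rcons rcons_cons /= mulmxA.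
Qed.

Lemma size_betas s : size (betas C s) = size s.
Proof. by elim/last_ind: s => // s i IH; rewrite betas_rcons !size_rcons IH. Qed.

Lemma is_root_betas s b : b \in betas C s -> is_root C b.
Proof.
by elim/last_ind: s => // s i IH; rewrite betas_rcons mem_rcons inE => /orP[/eqP->|/IH].
Qed.

Definition inversion w b := pos_root C b /\ exists g, neg_root C g /\ b = w *m g.

Lemma inversion_mul_sref w i b : W w -> ~~ descent w i ->
  inversion (w *m s_ i) b <-> b = w *m alpha i \/ inversion w b.
Proof.
move=> Ww asc_i; have pos_wi := pos_root_ascent Ww asc_i; split.
  case=> pos_b [g [neg_g Eb]]; have [Eg|pos_sg] := sref_pos_root i neg_g.
    by left; rewrite Eb -[g]opprK Eg mulmxN mul_sref_root // opprK.
  by right; split=> //; exists (s_ i *m g); rewrite /neg_root -mulmxN Eb mulmxA.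
case=> [->|[pos_b [g [neg_g Eb]]]].
  split=> //; exists (- alpha i); rewrite mulmxN mul_sref_root // opprK.
  by split=> //; rewrite /neg_root opprK; apply: pos_root_simple.
split=> //; exists (s_ i *m g); rewrite mulmxA srefK //; split=> //.
rewrite /neg_root -mulmxN; have [Eg|//] := sref_pos_root i neg_g.
by case: (pos_root_not_neg pos_b); rewrite Eb /neg_root -mulmxN Eg.
Qed.

Lemma mem_betas s b : reduced C s -> b \in betas C s <-> inversion (word s) b.
Proof.
elim/last_ind: s b => [|s i IH] b red_si.
  by split=> // -[pos_b [g [neg_g Eb]]]; case: (pos_root_not_neg pos_b); rewrite Eb mul1mx.
rewrite betas_rcons mem_rcons inE wordmx_rcons.
have red_s := reduced_rcons red_si.
rewrite inversion_mul_sref ?reduced_rcons_ascent //.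
by split=> [/orP[/eqP|/IH]|[->|/IH->//]]; rewrite ?eqxx; auto; rewrite orbT.
Qed.

Lemma uniq_betas s : reduced C s -> uniq (betas C s).
Proof.
elim/last_ind: s => // s i IH red_si; have red_s := reduced_rcons red_si.
rewrite betas_rcons rcons_uniq IH // andbT; apply/negP => /mem_betas-/(_ red_s)[_ [g [neg_g]]].
have [v [_ vw _]] := inW_inv (inW_word s).
move/(congr1 (mulmx v)); rewrite !mulmxA vw !mul1mx => Eg.
by case: (pos_root_not_neg (pos_root_simple i)); rewrite Eg.
Qed.

Lemma mem_posroots b : b \in posroots C Wl <-> pos_root C b.
Proof.
rewrite mem_filter mem_undup; split=> [/andP[/pbP] //|pos_b].
apply/andP; split; first exact/pbP.
have [[w [i [/enumW Ww ->]]] _] := pos_b; apply/allpairsP.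
by exists (w, i); rewrite mem_enum.
Qed.

Lemma uniq_posroots : uniq (posroots C Wl).
Proof. by rewrite filter_uniq // undup_uniq. Qed.

Lemma perm_inversions_betas s : reduced C s ->
  perm_eq [seq b <- posroots C Wl | pb (exists g, neg_root C g /\ b = word s *m g)] (betas C s).
Proof.
move=> red_s; apply: uniq_perm => [||b]; [exact/filter_uniq/uniq_posroots | exact: uniq_betas |].
rewrite mem_filter; apply/andP/idP => [[/pbP inv_b /mem_posroots pos_b]|].
  by apply/(mem_betas _ red_s).
by move/(mem_betas _ red_s) => [pos_b inv_b]; split; [apply/pbP | apply/mem_posroots].
Qed.

(** * The longest element *)

Section Longest.
Variable w0 : 'M[int]_n.
Hypothesis longest_w0 : longest C w0.

Let W0 : W w0. Proof. by case: longest_w0. Qed.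

Lemma longest_descent i : descent w0 i.
Proof.
apply: contraT => asc_i; have [_ /(_ _ (inW_mul W0 (inW_sref i)))] := longest_w0.
by rewrite wlength_ascent // ltnn.
Qed.

Lemma longest_neg_root b : pos_root C b -> neg_root C (w0 *m b).
Proof.
case=> Rb pos_b; split; first exact/is_root_opp/is_root_mul.
rewrite -mulNmx; apply: cone_mul pos_b => i; rewrite mulNmx.
by apply/pbP; rewrite -cone_descent //; apply: longest_descent.
Qed.

Lemma longest_inv_neg_root y b : W y -> w0 *m y = 1%:M -> pos_root C b -> neg_root C (y *m b).
Proof.
move=> Wy w0y pos_b; have [Rb _] := pos_b.
have [/longest_neg_root|//] := pos_or_neg_root (is_root_mul Wy Rb).
by rewrite mulmxA w0y mul1mx => /(pos_root_not_neg pos_b).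
Qed.

Lemma longest_simple i : exists j, w0 *m alpha j = - alpha i.
Proof.
have [y [Wy _ w0y]] := inW_inv W0.
have [_ [c [c_ge0 Ec]]] := longest_inv_neg_root Wy w0y (pos_root_simple i).
have sum_c : alpha i = \sum_j c j 0 *: - (w0 *m alpha j).
  transitivity (- (w0 *m (C *m c))); first by rewrite -Ec mulmxN opprK mulmxA w0y mul1mx.
  rewrite mulmx_sum_simple mulmx_sumr -sumrN.
  by apply: eq_bigr => j _; rewrite scalerN scalemxAr.
have [j cj_neq0] : exists j, c j 0 != 0.
  apply/existsP; apply: contraNT (simple_root_neq0 i) => /existsPn c0.
  by rewrite sum_c big1 // => j _; rewrite (eqP (negbNE (c0 j))) scale0r.
have cone_w0 j' : cone (- (w0 *m alpha j')) by case: (longest_neg_root (pos_root_simple j')).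
exists j; have [||a a_ge0 Ej] := @cone_simple_extremal i 1 (- (w0 *m alpha j))
  (\sum_j' (c j' 0 - (j' == j)%:R) *: - (w0 *m alpha j')) (cone_w0 j).
- apply: big_ind => [|b b'|j' _]; [exact: cone0 | exact: coneD | apply: coneZ => //].
  have := c_ge0 j'; rewrite subr_ge0; case: eqP => // ->; lia.
- rewrite scale1r [in RHS]sum_c (bigD1 j) //= [in RHS](bigD1 j) //= eqxx scalerBl scale1r addrA.
  rewrite addrCA subrr addr0; congr (_ + _).
  by apply: eq_bigr => j' /negPf ->; rewrite subr0.
by rewrite -[LHS]opprK Ej (@root_scale_simple a i) ?scale1r // -Ej; apply/is_root_opp.
Qed.

Lemma sref_conj w i j : W w -> w *m alpha j = - alpha i -> w *m s_ j = s_ i *m w.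
Proof.
move=> Ww Ej; apply: eq_mulmx_col => l; rewrite -!mulmxA !mulmx_sref mulmxBr -scalemxAr Ej.
congr (_ - _); rewrite scalerN -scaleNr; congr (_ *: _).
have g_neq0 : weyl_form (alpha i) (alpha i) != 0 by rewrite gt_eqF ?weyl_form_root_gt0.
apply: (mulIf g_neq0); rewrite -weyl_form_simple.
have -> : alpha i = - (w *m alpha j) by rewrite Ej opprK.
rewrite !weyl_formNr weyl_formNl opprK !weyl_form_mul //.
by rewrite mulrN weyl_form_simple mulNr.
Qed.

Lemma perm_longest_posroots : perm_eq [seq - (w0 *m b) | b <- posroots C Wl] (posroots C Wl).
Proof.
have [y [Wy yw0 w0y]] := inW_inv W0.
apply: uniq_perm => [||b].
- rewrite map_inj_uniq ?uniq_posroots // => b c /oppr_inj/(congr1 (mulmx y)).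
  by rewrite !mulmxA yw0 !mul1mx.
- exact: uniq_posroots.
apply/mapP/idP => [[c /mem_posroots pos_c ->]|/mem_posroots pos_b].
  exact/mem_posroots/longest_neg_root.
exists (- (y *m b)); last by rewrite mulmxN opprK mulmxA w0y mul1mx.
exact/mem_posroots/longest_inv_neg_root.
Qed.

Lemma perm_betas_longest : perm_eq (betas C (rev (rword C w0))) (posroots C Wl).
Proof.
have red_s := reduced_rev (reduced_rword W0).
have vw0 : word (rev (rword C w0)) *m w0 = 1%:M.
  by rewrite -{2}(wordmx_rword W0) wordmx_rev_mul.
apply: uniq_perm => [||b]; [exact: uniq_betas | exact: uniq_posroots |].
apply/idP/idP => [/(mem_betas _ red_s)[pos_b _] | /mem_posroots pos_b]; first exact/mem_posroots.
apply/(mem_betas _ red_s); split=> //.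
by exists (w0 *m b); rewrite mulmxA vw0 mul1mx; split=> //; apply: longest_neg_root.
Qed.

End Longest.

(** * Braid relations in rank two *)

Section RankTwoBraid.
Variables (K : comNzRingType) (t tau : K) (T : Type) (si sj : T -> T).
Hypotheses (siK : involutive si) (sjK : involutive sj) (tau_eq : tau = 0 \/ tau = t).
Implicit Types (f u : T -> K) (z : T).

Definition twisted_diff (s : T -> T) u f z : K := (f (s z) - f z) * u z + tau * f z.

Lemma braid_A1A1 (u10 u01 : T -> K) f z :
  (forall z, u10 (sj z) = u10 z) -> (forall z, u01 (si z) = u01 z) ->
  si (sj z) = sj (si z) ->
  twisted_diff si u10 (twisted_diff sj u01 f) z = twisted_diff sj u01 (twisted_diff si u10 f) z.
Proof. by move=> j10 i01 Ez; rewrite /twisted_diff j10 i01 Ez; ring. Qed.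

(* The relation between 1/x_b, 1/x_c and 1/x_(b + c).  In this section, uab z stands for
   1/x_(z (a alpha_i + b alpha_j)). *)
Definition sum_rel (a b c : K) := a * b = c * (a + b - t).

Lemma sum_rel_chain (u10 u11 u12 u01 : K) : sum_rel u10 u01 u11 -> sum_rel u11 u01 u12 ->
  u10 * u01 = u10 * u11 + u11 * u12 + u12 * u01 - t * (u11 + u12).
Proof. by rewrite /sum_rel => E11 E12; rewrite E11; ring: E12. Qed.

Section TypeA2.
Variables u10 u11 u01 : T -> K.
Hypotheses (i10 : forall z, u10 (si z) = t - u10 z) (i11 : forall z, u11 (si z) = u01 z).
Hypotheses (j01 : forall z, u01 (sj z) = t - u01 z) (j11 : forall z, u11 (sj z) = u10 z).
Local Notation Di := (twisted_diff si u10).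
Local Notation Dj := (twisted_diff sj u01).

Lemma braid_A2 f z : sum_rel (u10 z) (u01 z) (u11 z) -> si (sj (si z)) = sj (si (sj z)) ->
  Di (Dj (Di f)) z = Dj (Di (Dj f)) z.
Proof.
have i01 z' : u01 (si z') = u11 z' by rewrite -i11 siK.
have j10 z' : u10 (sj z') = u11 z' by rewrite -j11 sjK.
rewrite /sum_rel /twisted_diff => E11 Ez.
rewrite !(i10, i11, i01, j10, j11, j01, siK, sjK) Ez.
by case: tau_eq => ->; ring: E11.
Qed.

End TypeA2.

Section TypeB2.
Variables u10 u11 u12 u01 : T -> K.
Hypotheses (i10 : forall z, u10 (si z) = t - u10 z) (i11 : forall z, u11 (si z) = u01 z).
Hypotheses (i12 : forall z, u12 (si z) = u12 z).
Hypotheses (j01 : forall z, u01 (sj z) = t - u01 z) (j10 : forall z, u10 (sj z) = u12 z).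
Hypotheses (j11 : forall z, u11 (sj z) = u11 z).
Local Notation Di := (twisted_diff si u10).
Local Notation Dj := (twisted_diff sj u01).

Lemma braid_B2 f z :
  sum_rel (u10 z) (u01 z) (u11 z) -> sum_rel (u11 z) (u01 z) (u12 z) ->
  si (sj (si (sj z))) = sj (si (sj (si z))) ->
  Di (Dj (Di (Dj f))) z = Dj (Di (Dj (Di f))) z.
Proof.
have i01 z' : u01 (si z') = u11 z' by rewrite -i11 siK.
have j12 z' : u12 (sj z') = u10 z' by rewrite -j10 sjK.
move=> E11 E12 Ez; have chain := sum_rel_chain E11 E12.
rewrite /twisted_diff !(i10, i11, i12, i01, j10, j11, j12, j01, siK, sjK) Ez.
by case: tau_eq => ->; ring: chain.
Qed.

End TypeB2.

(* For tau = 0, the coefficient of f (z s_j s_i) in Dj Di Dj Di Dj Di f z is u01 * u13 times the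
   left-hand side; in the other braid word it is the product of the six weights. *)
Lemma sum_rel_G2 (u10 u11 u23 u12 u13 u01 : K) :
  sum_rel u10 u01 u11 -> sum_rel u11 u01 u12 -> sum_rel u12 u01 u13 ->
  sum_rel u10 u13 u23 -> sum_rel u11 u12 u23 ->
  ((t - u13) * u12 + (t - u01) * u13 + u10 * u01) ^+ 2
    + (t - u13) * u12 * ((t - u12) * u23 - u10 * u01) + (t - u10) * u11 * (u10 * u01)
  = u10 * u11 * u12 * u23.
Proof.
rewrite /sum_rel => E11 E12 E13 E23 E23'.
have square_base : (t - u13) * u12 + (t - u01) * u13 + u10 * u01 = u11 * (u10 + u12 - t).
  by rewrite E11; ring: E12 E13.
have opp12 : (t - u12) * u23 = u11 * (u23 - u12) by ring: E23'.
have opp01 : (t - u01) * u13 = u12 * (u13 - u01) by ring: E13.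
have cross : (u10 + u13 - t) * (u23 - u01) = (u10 + u12 - t) * (u13 - u01).
  transitivity (u23 * (u10 + u13 - t) - (u10 + u13 - t) * u01); first by ring.
  by rewrite -E23; ring: E13.
rewrite expr2 {2}square_base opp12 opp01.
transitivity (u11 * u12 * ((u10 + u12 - t) * (u13 - u01) - (u10 + u13 - t) * (u23 - u01))
  + u10 * u11 * u12 * u23); first by ring: E11.
by rewrite cross subrr mulr0 add0r.
Qed.

Section TypeG2.
Variables u10 u11 u23 u12 u13 u01 : T -> K.
Hypotheses (i10 : forall z, u10 (si z) = t - u10 z) (i11 : forall z, u11 (si z) = u01 z).
Hypotheses (i23 : forall z, u23 (si z) = u13 z) (i12 : forall z, u12 (si z) = u12 z).
Hypotheses (j01 : forall z, u01 (sj z) = t - u01 z) (j10 : forall z, u10 (sj z) = u13 z).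
Hypotheses (j11 : forall z, u11 (sj z) = u12 z) (j23 : forall z, u23 (sj z) = u23 z).
Local Notation Di := (twisted_diff si u10).
Local Notation Dj := (twisted_diff sj u01).

Lemma braid_G2 f z :
  sum_rel (u10 z) (u01 z) (u11 z) -> sum_rel (u11 z) (u01 z) (u12 z) ->
  sum_rel (u12 z) (u01 z) (u13 z) -> sum_rel (u10 z) (u13 z) (u23 z) ->
  sum_rel (u11 z) (u12 z) (u23 z) ->
  si (sj (si (sj (si (sj z))))) = sj (si (sj (si (sj (si z))))) ->
  Di (Dj (Di (Dj (Di (Dj f))))) z = Dj (Di (Dj (Di (Dj (Di f))))) z.
Proof.
have i13 z' : u13 (si z') = u23 z' by rewrite -i23 siK.
have i01 z' : u01 (si z') = u11 z' by rewrite -i11 siK.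
have j13 z' : u13 (sj z') = u10 z' by rewrite -j10 sjK.
have j12 z' : u12 (sj z') = u11 z' by rewrite -j11 sjK.
move=> E11 E12 E13 E23 E23' Ez.
have chain : u10 z * u01 z = u10 z * u11 z + u11 z * u23 z + u23 z * u12 z + u12 z * u13 z
    + u13 z * u01 z - t * (u11 z + u23 z + u12 z + u13 z).
  by rewrite (sum_rel_chain E11 E12) E13 E23'; ring.
have square : u12 z ^+ 2 * u13 z ^+ 2 = u12 z ^+ 2 * u13 z ^+ 2 + u10 z * u11 z * u12 z * u23 z
    - (((t - u13 z) * u12 z + (t - u01 z) * u13 z + u10 z * u01 z) ^+ 2
       + (t - u13 z) * u12 z * ((t - u12 z) * u23 z - u10 z * u01 z)
       + (t - u10 z) * u11 z * (u10 z * u01 z)) by rewrite sum_rel_G2 // addrK.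
rewrite /twisted_diff.
rewrite !(i10, i11, i23, i12, i13, i01, j10, j11, j23, j12, j13, j01, siK, sjK) Ez.
(* [ring] does not apply [chain] inside the right-hand side of [square]; the squares occurring
   there cancel during normalization. *)
by rewrite chain in square; case: tau_eq => ->; ring: chain square.
Qed.

End TypeG2.
End RankTwoBraid.

(** * Demazure operators *)

Section ConnectiveKTheory.
Variables (K : comUnitRingType) (t : K) (x : 'cV[int]_n -> K).
Hypotheses (fgl_x : fgl_ok t x) (unit_x : roots_invertible x C).
Implicit Types (f g : 'M[int]_n -> K) (tau : K).
Local Notation u b := (x b)^-1.

Lemma fgl_mulV b : is_root C b -> x b * u b = 1.
Proof. by move=> /unit_x/divrr. Qed.

Lemma fgl_opp b : x b + x (- b) = t * x b * x (- b).
Proof. by have [x0 xD] := fgl_x; apply/eqP; rewrite -subr_eq0 -xD subrr x0. Qed.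

Lemma fgl_inv_opp b : is_root C b -> u (- b) = t - u b.
Proof.
move=> Rb; have xu := fgl_mulV Rb; have xuN := fgl_mulV (is_root_opp Rb).
have xE : x b = t * x b * x (- b) - x (- b) by rewrite -fgl_opp addrK.
transitivity (x b * u b * u (- b)); first by rewrite xu mul1r.
by rewrite {1}xE; ring: xu xuN.
Qed.

Lemma fgl_inv_sum_rel b c : is_root C b -> is_root C c -> is_root C (b + c) ->
  sum_rel t (u b) (u c) (u (b + c)).
Proof.
move=> /fgl_mulV xub /fgl_mulV xuc Rbc; have [_ xD] := fgl_x.
apply: (mulrI (unit_x Rbc)); rewrite [RHS]mulrA fgl_mulV // mul1r xD.
by ring: xub xuc.
Qed.

Lemma fgl_exp_inv b : (1 - t * x b)^-1 = 1 - t * x (- b).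
Proof.
have mul1 : (1 - t * x b) * (1 - t * x (- b)) = 1.
  transitivity (1 - t * (x b + x (- b)) + t * (t * x b * x (- b))); first by ring.
  by rewrite fgl_opp subrK.
have unit_b : 1 - t * x b \is a GRing.unit by apply/unitrPr; exists (1 - t * x (- b)).
by apply: (mulrI unit_b); rewrite divrr.
Qed.

(* X_i for tau = 0 and Y_i for tau = t, since 1/x_{-b} = t - 1/x_b. *)
Definition demazure tau i f w : K := GX x C i f w + tau * f w.
Definition demazure_word tau f s : 'M[int]_n -> K := foldr (demazure tau) f s.

Lemma demazure_word_cat tau f s r :
  demazure_word tau f (s ++ r) = demazure_word tau (demazure_word tau f r) s.
Proof. exact: foldr_cat. Qed.

Lemma demazure_word_rcons tau f s i :
  demazure_word tau f (rcons s i) = demazure_word tau (demazure tau i f) s.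
Proof. exact: foldr_rcons. Qed.

Lemma eq_demazure_word tau f g s : (forall w, W w -> f w = g w) ->
  forall w, W w -> demazure_word tau f s w = demazure_word tau g s w.
Proof. by move=> fg; elim: s => //= i s IH w Ww; rewrite /demazure /GX !IH. Qed.

(* The weights 1/x_(w b) satisfy their relations only for w in W, whereas the rank two braid
   relations above quantify over all points of a type. *)
Definition weyl_elt := {w : 'M[int]_n | pb (W w)}.
Implicit Types z : weyl_elt.

Lemma weyl_eltP z : W (val z). Proof. exact/pbP/(valP z). Qed.

Definition weyl_elt_sref z i : weyl_elt :=
  Sub (val z *m s_ i) (introT (pbP _) (inW_mul (weyl_eltP z) (inW_sref i))).

Lemma weyl_elt_srefK i : involutive (weyl_elt_sref^~ i).
Proof. by move=> z; apply: val_inj; rewrite /= srefK. Qed.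

Lemma weyl_elt_braid i j m z : braid_order i j m ->
  foldl weyl_elt_sref z (altword m i j) = foldl weyl_elt_sref z (altword m j i).
Proof.
have val_foldl s z' : val (foldl weyl_elt_sref z' s) = val z' *m word s.
  by elim: s z' => [|e s IH] z' /=; rewrite ?mulmx1 // IH /= mulmxA.
by move=> ord_m; apply: val_inj; rewrite !val_foldl (word_braid ord_m).
Qed.

Definition inv_x b z : K := u (val z *m b).

Lemma inv_x_sref i z : inv_x (alpha i) (weyl_elt_sref z i) = t - inv_x (alpha i) z.
Proof. by have Wz := weyl_eltP z; rewrite /inv_x mul_sref_root fgl_inv_opp. Qed.

Section RankTwoRoots.
Variables (i j : 'I_n) (p q : int).
Hypotheses (Cij : - C i j = p) (Cji : - C j i = q).
Local Notation comb := (simple_comb i j).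

Lemma sref_simple_combl (a b : int) : s_ i *m comb a b = comb (p * b - a) b.
Proof. by rewrite -Cij sref_simple_comb. Qed.

Lemma sref_simple_combr (a b : int) : s_ j *m comb a b = comb a (q * a - b).
Proof. by rewrite -Cji simple_combC sref_simple_comb simple_combC. Qed.

Lemma is_root_srefl (a b : int) : is_root C (comb a b) -> is_root C (comb (p * b - a) b).
Proof. by move/(is_root_mul (inW_sref i)); rewrite sref_simple_combl. Qed.

Lemma is_root_srefr (a b : int) : is_root C (comb a b) -> is_root C (comb a (q * a - b)).
Proof. by move/(is_root_mul (inW_sref j)); rewrite sref_simple_combr. Qed.

Lemma inv_x_srefl (a b : int) z :
  inv_x (comb a b) (weyl_elt_sref z i) = inv_x (comb (p * b - a) b) z.
Proof. by rewrite /inv_x -mulmxA sref_simple_combl. Qed.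

Lemma inv_x_srefr (a b : int) z :
  inv_x (comb a b) (weyl_elt_sref z j) = inv_x (comb a (q * a - b)) z.
Proof. by rewrite /inv_x -mulmxA sref_simple_combr. Qed.

Lemma inv_x_sum_rel (a b a' b' : int) z :
  is_root C (comb a b) -> is_root C (comb a' b') -> is_root C (comb (a + a') (b + b')) ->
  sum_rel t (inv_x (comb a b) z) (inv_x (comb a' b') z) (inv_x (comb (a + a') (b + b')) z).
Proof.
have Wz := weyl_eltP z.
have -> : comb (a + a') (b + b') = comb a b + comb a' b'.
  by rewrite /simple_comb !scalerDl addrACA.
move=> R R' RR'; have := fgl_inv_sum_rel (is_root_mul Wz R) (is_root_mul Wz R').
by rewrite -mulmxDr; apply.
Qed.

End RankTwoRoots.

Section DemazureBraid.
Variables (tau : K) (i j : 'I_n) (f : 'M[int]_n -> K) (w : 'M[int]_n).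
Hypotheses (tau_eq : tau = 0 \/ tau = t) (Ww : W w).
Local Notation iK := (weyl_elt_srefK i).
Local Notation jK := (weyl_elt_srefK j).
Local Notation root a b := (is_root C (simple_comb i j a b)).
Local Notation u_ a b := (inv_x (simple_comb i j a b)).
Local Notation z := (Sub w (introT (pbP _) Ww) : weyl_elt).
Local Notation braid m :=
  (demazure_word tau f (altword m i j) w = demazure_word tau f (altword m j i) w).

Let root10 : root 1 0. Proof. by rewrite simple_comb10. Qed.
Let root01 : root 0 1. Proof. by rewrite simple_comb01. Qed.

Lemma demazure_word_A1A1 : - C i j = 0 -> - C j i = 0 -> braid 2.
Proof.
move=> Cij Cji; have ui := inv_x_srefl Cij; have uj := inv_x_srefr Cji.
have ord_m : braid_order i j 2 by left; rewrite Cij Cji; constructor.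
apply/esym; apply: (@braid_A1A1 _ tau _ (weyl_elt_sref^~ i) (weyl_elt_sref^~ j)
  (inv_x (alpha i)) (inv_x (alpha j)) (f \o val) z).
- by move=> v; rewrite -(simple_comb10 i j) uj.
- by move=> v; rewrite -(simple_comb01 i j) ui.
exact: (weyl_elt_braid z ord_m).
Qed.

Lemma demazure_word_A2 : - C i j = 1 -> - C j i = 1 -> braid 3.
Proof.
move=> Cij Cji; have ui := inv_x_srefl Cij; have uj := inv_x_srefr Cji.
have ord_m : braid_order i j 3 by left; rewrite Cij Cji; constructor.
have root11 : root 1 1 := is_root_srefl Cij root01.
apply: (@braid_A2 _ _ tau _ _ _ iK jK tau_eq (inv_x (alpha i)) (u_ 1 1) (inv_x (alpha j))
  _ _ _ _ (f \o val) z).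
- exact: inv_x_sref.
- by move=> v; rewrite -(simple_comb01 i j) ui.
- exact: inv_x_sref.
- by move=> v; rewrite -(simple_comb10 i j) uj.
- rewrite -(simple_comb10 i j) -(simple_comb01 i j); exact: inv_x_sum_rel root10 root01 root11.
exact: (weyl_elt_braid z ord_m).
Qed.

Lemma demazure_word_B2 : - C i j = 1 -> - C j i = 2 -> braid 4.
Proof.
move=> Cij Cji; have ui := inv_x_srefl Cij; have uj := inv_x_srefr Cji.
have ord_m : braid_order i j 4 by left; rewrite Cij Cji; constructor.
have root11 : root 1 1 := is_root_srefl Cij root01.
have root12 : root 1 2 := is_root_srefr Cji root10.
apply/esym; apply: (@braid_B2 _ _ tau _ _ _ iK jK tau_eq (inv_x (alpha i)) (u_ 1 1) (u_ 1 2)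
  (inv_x (alpha j)) _ _ _ _ _ _ (f \o val) z).
- exact: inv_x_sref.
- by move=> v; rewrite -(simple_comb01 i j) ui.
- by move=> v; rewrite ui.
- exact: inv_x_sref.
- by move=> v; rewrite -(simple_comb10 i j) uj.
- by move=> v; rewrite uj.
- rewrite -(simple_comb10 i j) -(simple_comb01 i j); exact: inv_x_sum_rel root10 root01 root11.
- rewrite -(simple_comb01 i j); exact: inv_x_sum_rel root11 root01 root12.
exact: (weyl_elt_braid z ord_m).
Qed.

Lemma demazure_word_G2 : - C i j = 1 -> - C j i = 3 -> braid 6.
Proof.
move=> Cij Cji; have ui := inv_x_srefl Cij; have uj := inv_x_srefr Cji.
have ord_m : braid_order i j 6 by left; rewrite Cij Cji; constructor.
have root11 : root 1 1 := is_root_srefl Cij root01.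
have root12 : root 1 2 := is_root_srefr Cji root11.
have root13 : root 1 3 := is_root_srefr Cji root10.
have root23 : root 2 3 := is_root_srefl Cij root13.
apply/esym; apply: (@braid_G2 _ _ tau _ _ _ iK jK tau_eq (inv_x (alpha i)) (u_ 1 1) (u_ 2 3)
  (u_ 1 2) (u_ 1 3) (inv_x (alpha j)) _ _ _ _ _ _ _ _ (f \o val) z).
- exact: inv_x_sref.
- by move=> v; rewrite -(simple_comb01 i j) ui.
- by move=> v; rewrite ui.
- by move=> v; rewrite ui.
- exact: inv_x_sref.
- by move=> v; rewrite -(simple_comb10 i j) uj.
- by move=> v; rewrite uj.
- by move=> v; rewrite uj.
- rewrite -(simple_comb10 i j) -(simple_comb01 i j); exact: inv_x_sum_rel root10 root01 root11.
- rewrite -(simple_comb01 i j); exact: inv_x_sum_rel root11 root01 root12.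
- rewrite -(simple_comb01 i j); exact: inv_x_sum_rel root12 root01 root13.
- rewrite -(simple_comb10 i j); exact: inv_x_sum_rel root10 root13 root23.
- exact: inv_x_sum_rel root11 root12 root23.
exact: (weyl_elt_braid z ord_m).
Qed.

End DemazureBraid.

Lemma demazure_word_braid tau i j m f w : tau = 0 \/ tau = t -> W w -> braid_order i j m ->
  demazure_word tau f (altword m i j) w = demazure_word tau f (altword m j i) w.
Proof.
move=> tau_eq Ww; suff braid i' j' : rank2_type (- C i' j') (- C j' i') m ->
    demazure_word tau f (altword m i' j') w = demazure_word tau f (altword m j' i') w.
  by case=> [/braid | /braid ->].
move Ep : (- C i' j') => p; move Eq : (- C j' i') => q type_m.
case: type_m Ep Eq.
- exact: demazure_word_A1A1.
- exact: demazure_word_A2.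
- exact: demazure_word_B2.
exact: demazure_word_G2.
Qed.

Section DemazureWord.
Variable tau : K.
Hypothesis tau_eq : tau = 0 \/ tau = t.
Local Notation D := (demazure tau).
Local Notation Ds := (demazure_word tau).

Lemma demazure_quadratic f i w : W w -> D i (D i f) w = (2 * tau - t) * D i f w.
Proof.
move=> Ww; rewrite /demazure /GX srefK // mul_sref_root // fgl_inv_opp //.
by case: tau_eq => ->; ring.
Qed.

Lemma demazure_word_reduced f s r w : W w -> reduced C s -> reduced C r -> word s = word r ->
  Ds f s w = Ds f r w.
Proof.
move=> Ww; apply: (matsumoto (F := fun s => Ds f s w)) => q1 q2 i j m ord_m.
rewrite !demazure_word_cat; apply: eq_demazure_word => // v Wv.
exact: demazure_word_braid.
Qed.

Lemma demazure_rword_ascent f v i w : W v -> W w -> ~~ descent v i ->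
  Ds (D i f) (rword C v) w = Ds f (rword C (v *m s_ i)) w.
Proof.
move=> Wv Ww asc_i; rewrite -demazure_word_rcons.
apply: demazure_word_reduced => //; [exact: reduced_rword_rcons | exact: reduced_rword |].
by rewrite wordmx_rcons !wordmx_rword.
Qed.

Lemma demazure_wordZ (a : K) f s w : Ds (fun v => a * f v) s w = a * Ds f s w.
Proof. by elim: s w => //= i s IH w; rewrite /demazure /GX !IH; ring. Qed.

Lemma demazure_word_sum (I : eqType) (r : seq I) (a : I -> K) (F : I -> 'M[int]_n -> K) s w :
  Ds (fun v => \sum_(e <- r) a e * F e v) s w = \sum_(e <- r) a e * Ds (F e) s w.
Proof.
elim: s w => //= i s IH w; rewrite /demazure /GX !IH -sumrB mulr_suml mulr_sumr -big_split.
by apply: eq_bigr => e _ /=; ring.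
Qed.

Lemma demazure_rword_descent f v i w : W v -> W w -> descent v i ->
  Ds (D i f) (rword C v) w = (2 * tau - t) * Ds f (rword C v) w.
Proof.
move=> Wv Ww desc_i; have asc_i := ascent_mul_sref desc_i.
have shift g : Ds g (rword C v) w = Ds (D i g) (rword C (v *m s_ i)) w.
  by rewrite demazure_rword_ascent ?srefK.
rewrite !shift -demazure_wordZ; apply: eq_demazure_word => // v' Wv'.
exact: demazure_quadratic.
Qed.

Lemma demazure_word_vanish f s w :
  (forall r, (size r <= size s)%N -> f (w *m word r) = 0) -> Ds f s w = 0.
Proof.
elim: s w => [|i s IH] w f0 /=; first by rewrite -[w]mulmx1 (f0 [::]).
rewrite /demazure /GX !IH ?subrr ?mul0r ?mulr0 ?addr0 // => r le_rs; first by rewrite f0 // ltnW.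
by rewrite -mulmxA -[s_ i *m _]/(word (i :: r)) f0.
Qed.

Lemma demazure_word_lead f s w : (forall r, (size r < size s)%N -> f (w *m word r) = 0) ->
  Ds f s w = f (w *m word s) * \prod_(b <- betas C s) u (w *m b).
Proof.
elim: s w => [|i s IH] w f0 /=; first by rewrite mulmx1 big_nil mulr1.
rewrite /demazure /GX (@demazure_word_vanish f s w) => [|r le_rs]; last by rewrite f0.
rewrite subr0 mulr0 addr0 IH => [|r lt_rs]; last first.
  by rewrite -mulmxA -[s_ i *m _]/(word (i :: r)) f0.
rewrite betas_cons big_cons [in RHS]big_map mulmxA -mulrA [_ * u _]mulrC; congr (_ * (_ * _)).
by apply: eq_bigr => b _; rewrite mulmxA.
Qed.

Definition point_fun v w : K := (w == v)%:R.

Lemma sum_point_fun f w : W w -> f w = \sum_(v <- undup Wl) f v * point_fun v w.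
Proof.
move=> Ww; have Mw : w \in undup Wl by rewrite mem_undupW; apply/pbP.
rewrite (bigD1_seq w) ?undup_uniq //= /point_fun eqxx mulr1 big1 ?addr0 // => v.
by rewrite eq_sym => /negPf->; rewrite mulr0.
Qed.

Lemma demazure_word_point_fun f s w : W w ->
  Ds f s w = \sum_(v <- undup Wl) f v * Ds (point_fun v) s w.
Proof. by move=> Ww; rewrite (eq_demazure_word tau s (sum_point_fun f)) // demazure_word_sum. Qed.

Lemma demazure_rword_point_fun v w : W v -> W w -> (ell w <= ell v)%N ->
  Ds (point_fun v) (rword C w) 1%:M =
  if w == v then \prod_(b <- betas C (rword C v)) u b else 0.
Proof.
move=> Wv Ww le_wv; rewrite demazure_word_lead => [|r lt_r]; last first.
  rewrite /point_fun mul1mx; case: eqP => // Er.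
  by have := leq_trans lt_r le_wv; rewrite -Er ltnNge wlength_word.
rewrite mul1mx wordmx_rword // /point_fun; case: eqP => [->|_]; last by rewrite mul0r.
by rewrite /= mul1r; apply: eq_bigr => b _; rewrite mul1mx.
Qed.

Lemma demazure_rword_free (d : 'M[int]_n -> K) :
  (forall v, W v -> \sum_(w <- undup Wl) d w * Ds (point_fun v) (rword C w) 1%:M = 0) ->
  forall v, W v -> d v = 0.
Proof.
move=> d0 v; pose N := \max_(w <- undup Wl) ell w.
have le_N w : W w -> (ell w <= N)%N.
  by move=> Ww; apply: leq_bigmax_seq; rewrite ?mem_undupW //; apply/pbP.
move: {2}(N - ell v).+1 (ltnSn (N - ell v)) => m; elim: m v => // m IH v lt_m Wv.
have Mv : v \in undup Wl by rewrite mem_undupW; apply/pbP.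
have := d0 v Wv; rewrite (bigD1_seq v) ?undup_uniq //= demazure_rword_point_fun // eqxx.
rewrite [X in _ + X]big_seq_cond [X in _ + X]big1 ?addr0 => [|w /andP[]]; last first.
  rewrite mem_undupW => /pbP Ww neq_wv; have [lt_vw|le_wv] := ltnP (ell v) (ell w).
    by rewrite IH ?mul0r //; have := le_N w Ww; move: lt_m lt_vw; lia.
  by rewrite demazure_rword_point_fun // (negPf neq_wv) mulr0.
have unit_prod : \prod_(b <- betas C (rword C v)) u b \is a GRing.unit.
  rewrite big_seq; apply: rpred_prod => b Mb; rewrite unitrV; exact/unit_x/is_root_betas/Mb.
by move=> dv0; apply: (mulIr unit_prod); rewrite mul0r.
Qed.

End DemazureWord.

(** * Expansions in the twisted group algebra *)

Section TwistedGroupAlgebra.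
Variable act : 'M[int]_n -> K -> K.
Hypothesis act_W : act_ok t x act C.
Implicit Types (a : QW n K).

(* The value at delta_w * a of the left Q-linear extension of f to Q_W. *)
Definition qact a f w : K := \sum_(p <- a) act w p.1 * f (w *m p.2).

Lemma qcoef_qact a v : qcoef a v = qact a (point_fun v) 1%:M.
Proof.
rewrite /qcoef big_mkcond; apply: eq_bigr => p _; rewrite mul1mx /point_fun.
by have [-> _ _] := act_W; case: eqP; rewrite ?mulr1 ?mulr0.
Qed.

Lemma act_inv_x w b : W w -> is_root C b -> act w (u b) = u (w *m b).
Proof.
move=> Ww Rb; have [_ _ /(_ w Ww)[_ actM act1 _ actx]] := act_W.
by apply: (mulrI (unit_x (is_root_mul Ww Rb))); rewrite fgl_mulV // -{1}actx -actM fgl_mulV.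
Qed.

Lemma actN w (y : K) : W w -> act w (- y) = - act w y.
Proof.
move=> Ww; have [_ _ /(_ w Ww)[actD _ _ _ _]] := act_W.
have act0 : act w 0 = 0 by apply: (addrI (act w 0)); rewrite -actD !addr0.
by apply/eqP; rewrite -addr_eq0 -actD addNr act0.
Qed.

Lemma qact_mul a a' f w : W w -> all (fun p => pb (W p.2)) a ->
  qact (qmul act a a') f w = \sum_(p <- a) act w p.1 * qact a' f (w *m p.2).
Proof.
have [_ actA act_mor] := act_W; move=> Ww /allP Wa; have [_ actM _ _ _] := act_mor w Ww.
rewrite /qact /qmul big_allpairs_dep /=; apply: eq_big_seq => p /Wa/pbP Wp.
by rewrite mulr_sumr; apply: eq_bigr => e _; rewrite actM actA // mulmxA mulrA.
Qed.

Lemma qact_one f w : W w -> qact (qone n K) f w = f w.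
Proof.
move=> Ww; have [_ _ /(_ w Ww)[_ _ act1 _ _]] := act_W.
by rewrite /qact big_seq1 /= act1 mul1r mulmx1.
Qed.

Lemma qact_Xword s f w : W w -> qact (Xword x act C s) f w = demazure_word 0 f s w.
Proof.
elim: s w => [|i s IH] w Ww /=; first exact: qact_one.
rewrite qact_mul //=; last by rewrite !andbT; apply/andP; split; apply/pbP.
rewrite big_cons big_seq1 /= actN // act_inv_x // mulmx1 !IH //.
by rewrite /demazure /GX; ring.
Qed.

Lemma qact_Yword s f w : W w -> qact (Yword x act C s) f w = demazure_word t f s w.
Proof.
elim: s w => [|i s IH] w Ww /=; first exact: qact_one.
rewrite qact_mul //=; last by rewrite !andbT; apply/andP; split; apply/pbP.
have RN : is_root C (- alpha i) by apply: is_root_opp.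
rewrite big_cons big_seq1 /= !act_inv_x // mulmx1 !IH // mulmxN fgl_inv_opp //.
by rewrite /demazure /GX; ring.
Qed.

Section Expansion.
Variables (tau : K) (op : seq 'I_n -> QW n K).
Hypothesis tau_eq : tau = 0 \/ tau = t.
Hypothesis qact_op : forall s f w, W w -> qact (op s) f w = demazure_word tau f s w.
Local Notation D := (demazure tau).
Local Notation Ds := (demazure_word tau).
Local Notation basis := (fun v => op (rword C v)).
Local Notation expansion s c := (coefs_in basis Wl (op s) c).

Lemma expansionP s (c : 'M[int]_n -> K) : expansion s c <->
  forall f, Ds f s 1%:M = \sum_(v <- undup Wl) c v * Ds f (rword C v) 1%:M.
Proof.
have coefE v : qcoef (flatten [seq qscale (c w) (basis w) | w <- undup Wl]) v =
    \sum_(w <- undup Wl) c w * Ds (point_fun v) (rword C w) 1%:M.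
  rewrite /qcoef big_flatten /= big_map; apply: eq_bigr => w _.
  by rewrite /qscale big_map -qact_op // -qcoef_qact /qcoef mulr_sumr; apply: eq_bigl.
split=> [exp_c f | exp_c v]; last by rewrite coefE qcoef_qact qact_op.
rewrite demazure_word_point_fun //; under [RHS]eq_bigr do
  rewrite demazure_word_point_fun // mulr_sumr.
rewrite exchange_big; apply: eq_bigr => v _ /=.
rewrite -qact_op // -qcoef_qact exp_c coefE mulr_sumr.
by apply: eq_bigr => w _; ring.
Qed.

Lemma expansion_nil : expansion [::] (fun v => (v == 1%:M)%:R).
Proof.
apply/expansionP => f; have M1 : 1%:M \in undup Wl by rewrite mem_undupW; apply/pbP.
rewrite (bigD1_seq 1%:M) ?undup_uniq //= eqxx mul1r (size0nil wlength1) big1 ?addr0 // => v.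
by move/negPf->; rewrite mul0r.
Qed.

Lemma expansion_rcons s (c : 'M[int]_n -> K) i : expansion s c -> expansion (rcons s i)
  (fun v => if descent v i then c (v *m s_ i) + (2 * tau - t) * c v else 0).
Proof.
move/expansionP => exp_c; apply/expansionP => f; rewrite demazure_word_rcons exp_c.
pose value v := Ds f (rword C v) 1%:M.
transitivity (\sum_(v <- undup Wl) (if descent v i then 0 else c v * value (v *m s_ i))
    + \sum_(v <- undup Wl) (if descent v i then (2 * tau - t) * c v * value v else 0)).
  rewrite -big_split /=; apply: eq_big_seq => v; rewrite mem_undupW => /pbP Wv.
  have [desc_i|asc_i] := boolP (descent v i).
    by rewrite demazure_rword_descent // add0r mulrCA mulrA.
  by rewrite demazure_rword_ascent // addr0.
rewrite -[X in X + _](perm_big _ (perm_mulr_undupW (inW_sref i))) big_map -big_split /=.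
apply: eq_big_seq => v; rewrite mem_undupW => /pbP Wv; rewrite srefK //.
rewrite descent_mul_sref //.
by case: (descent v i); rewrite ?add0r ?addr0 ?mul0r ?mulrDl.
Qed.

Lemma expansion_exists s : exists c : 'M[int]_n -> K, expansion s c.
Proof.
elim/last_ind: s => [|s i [c exp_c]]; first by eexists; apply: expansion_nil.
by eexists; apply: expansion_rcons exp_c.
Qed.

Lemma expansion_unique s (c d : 'M[int]_n -> K) v :
  expansion s c -> expansion s d -> W v -> c v = d v.
Proof.
move=> /expansionP exp_c /expansionP exp_d Wv; apply/eqP; rewrite -subr_eq0; apply/eqP.
move: v Wv; apply: (@demazure_rword_free tau) => v Wv.
under eq_bigr do rewrite mulrBl.
by rewrite sumrB -exp_c -exp_d subrr.
Qed.

Lemma bcoef_expansion s : expansion s (bcoef basis Wl (op s)).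
Proof.
exact: (epsilon_spec (inhabits (fun _ => 0)) (coefs_in basis Wl (op s)) (expansion_exists s)).
Qed.

Lemma bcoef_nil v : W v -> bcoef basis Wl (op [::]) v = (v == 1%:M)%:R.
Proof. exact: expansion_unique (bcoef_expansion _) expansion_nil. Qed.

Lemma bcoef_rcons s i v : W v -> bcoef basis Wl (op (rcons s i)) v =
  if descent v i
  then bcoef basis Wl (op s) (v *m s_ i) + (2 * tau - t) * bcoef basis Wl (op s) v else 0.
Proof. exact: expansion_unique (bcoef_expansion _) (expansion_rcons i (bcoef_expansion s)). Qed.

Section RootPolynomial.
Variable eps : 'cV[int]_n -> K.

Definition root_poly s v : K := \sum_(m <- masks (size s))
  (\prod_(b <- mask m (betas C s)) eps b) * bcoef basis Wl (op (mask m s)) v.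

Lemma root_poly_nil v : W v -> root_poly [::] v = (v == 1%:M)%:R.
Proof. by move=> Wv; rewrite /root_poly big_seq1 /= big_nil mul1r bcoef_nil. Qed.

Lemma root_poly_rcons s i v : W v -> root_poly (rcons s i) v = root_poly s v +
  if descent v i
  then eps (word s *m alpha i) * (root_poly s (v *m s_ i) + (2 * tau - t) * root_poly s v) else 0.
Proof.
move=> Wv; rewrite /root_poly size_rcons big_masks_rcons betas_rcons; congr (_ + _).
  apply: eq_big_seq => m /size_masks size_m.
  by rewrite !mask_rcons ?size_betas // !cats0.
transitivity (\sum_(m <- masks (size s)) eps (word s *m alpha i) *
   ((\prod_(b <- mask m (betas C s)) eps b) * bcoef basis Wl (op (rcons (mask m s) i)) v)).
  apply: eq_big_seq => m /size_masks size_m.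
  rewrite !mask_rcons ?size_betas //= big_cat big_seq1 cats1 /=.
  by rewrite mulrA [eps _ * _]mulrC.
rewrite -mulr_sumr; under eq_bigr do rewrite bcoef_rcons //.
case: ifP => _; last by rewrite big1 ?mulr0 // => m _; rewrite mulr0.
by congr (_ * _); rewrite mulr_sumr -big_split; apply: eq_bigr => m _ /=; ring.
Qed.

End RootPolynomial.
End Expansion.
End TwistedGroupAlgebra.

(** * Schubert classes and root polynomials *)

Lemma theta_betas w : W w ->
  theta t x C Wl w = \prod_(b <- betas C (rword C w)) (1 - t * x b)^-1.
Proof.
move=> Ww; rewrite /theta -big_filter; apply: perm_big.
by have := perm_inversions_betas (reduced_rword Ww); rewrite wordmx_rword.
Qed.

Section GKM.
Variable w0 : 'M[int]_n.
Hypothesis longest_w0 : longest C w0.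
Let W0 : W w0. Proof. by case: longest_w0. Qed.

Section SchubertClass.
Variable tau : K.
Hypothesis tau_eq : tau = 0 \/ tau = t.
Local Notation D := (demazure tau).
Local Notation Ds := (demazure_word tau).

Definition schubert_class v := Ds (zeta0 x C Wl) (rev (rword C v)).
Definition opp_schubert_class v w := schubert_class (v *m w0) (w *m w0).

Lemma schubert_class_descent v i w : W v -> W w -> descent v i ->
  schubert_class v w = D i (schubert_class (v *m s_ i)) w.
Proof.
move=> Wv Ww desc_i; have Wvi : W (v *m s_ i) by [].
have red_vi := reduced_rword_rcons Wvi (ascent_mul_sref desc_i).
rewrite /schubert_class -[RHS]/(Ds _ (i :: rev (rword C (v *m s_ i))) w) -rev_rcons.
apply: demazure_word_reduced => //; [exact/reduced_rev/reduced_rword | exact: reduced_rev |].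
by apply: eq_wordmx_rev; rewrite wordmx_rcons !wordmx_rword // srefK.
Qed.

Lemma opp_schubert_class_ascent v w i : W v -> W w -> ~~ descent v i ->
  opp_schubert_class v w =
    (opp_schubert_class (v *m s_ i) (w *m s_ i) - opp_schubert_class (v *m s_ i) w)
      * u (- (w *m alpha i)) + tau * opp_schubert_class (v *m s_ i) w.
Proof.
move=> Wv Ww asc_i; have [j Ej] := longest_simple longest_w0 i.
have conj_j y : y *m w0 *m s_ j = y *m s_ i *m w0 by rewrite -mulmxA (sref_conj W0 Ej) mulmxA.
rewrite /opp_schubert_class (@schubert_class_descent _ j) //.
  by rewrite /demazure /GX !conj_j -[w *m w0 *m alpha j]mulmxA Ej mulmxN.
rewrite cone_descent // -mulmxA Ej mulmxN opprK.
by apply/pbP/cone_ascent.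
Qed.

Lemma opp_schubert_class_mul_sref v w i : W v -> W w ->
  opp_schubert_class v (w *m s_ i) =
    (1 - (t - tau) * x (- (w *m alpha i))) * opp_schubert_class v w +
    if descent v i
    then x (- (w *m alpha i)) *
      (opp_schubert_class (v *m s_ i) w + (2 * (t - tau) - t) * opp_schubert_class v w)
    else 0.
Proof.
move=> Wv Ww; have RN : is_root C (- (w *m alpha i)) by apply/is_root_opp/is_root_mul.
have xuN := fgl_mulV RN; have [desc_i|asc_i] := boolP (descent v i).
  rewrite (@opp_schubert_class_ascent (v *m s_ i) w i) ?descent_mul_sref ?desc_i // srefK.
  by ring: xuN.
rewrite !(@opp_schubert_class_ascent v _ i) // srefK mul_sref_root // opprK.
have -> : u (w *m alpha i) = t - u (- (w *m alpha i)) by rewrite -fgl_inv_opp // opprK.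
by case: tau_eq => ->; ring: xuN.
Qed.

Lemma schubert_class_at_longest v : W v -> schubert_class v w0 =
  zeta0 x C Wl (w0 *m word (rev (rword C v))) *
  \prod_(b <- betas C (rev (rword C v))) u (w0 *m b).
Proof.
move=> Wv; have [_ max0] := longest_w0; apply: demazure_word_lead => r.
rewrite size_rev -/(ell v) => lt_r; rewrite /zeta0; case: eqP => // w0r.
have := wlength_inv (inW_word r) w0r; have := wlength_word r; have := max0 _ Wv; lia.
Qed.

Lemma schubert_class_longest : schubert_class w0 w0 = 1.
Proof.
rewrite schubert_class_at_longest // -{1}(wordmx_rword W0) wordmx_mul_rev /zeta0 eqxx.
rewrite (perm_big _ (perm_betas_longest longest_w0)).
rewrite -[X in X * _](perm_big _ (perm_longest_posroots longest_w0)) big_map -big_split big_seq.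
by rewrite big1 // => b /mem_posroots[Rb _]; rewrite /= opprK fgl_mulV //; apply: is_root_mul.
Qed.

Lemma opp_schubert_class1 v : W v -> opp_schubert_class v 1%:M = (v == 1%:M)%:R.
Proof.
move=> Wv; have Wvw0 : W (v *m w0) by []; rewrite /opp_schubert_class mul1mx.
have [->|neq_v1] := eqVneq v 1%:M; first by rewrite mul1mx schubert_class_longest.
rewrite schubert_class_at_longest // /zeta0; case: eqP => [w0s|_]; last by rewrite mul0r.
case/eqP: neq_v1; apply: (inW_mulIr W0); rewrite mul1mx.
have := congr1 (mulmx^~ (v *m w0)) w0s; rewrite /= mul1mx => <-.
by rewrite -mulmxA -{2}(wordmx_rword Wvw0) wordmx_rev_mul mulmx1.
Qed.

End SchubertClass.

Lemma zetaX_schubert_class v w : zetaX x C Wl v w = schubert_class 0 v w.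
Proof.
rewrite /zetaX /schubert_class -{1}(revK (rword C v)) foldl_rev.
by elim: (rev _) w => //= i s IH w; rewrite /demazure /GX !IH mul0r addr0.
Qed.

Lemma zetaY_schubert_class v w : W w -> zetaY x C Wl v w = schubert_class t v w.
Proof.
rewrite /zetaY /schubert_class -{1}(revK (rword C v)) foldl_rev.
elim: (rev _) w => //= i s IH w Ww; rewrite /GY /demazure /GX !IH // fgl_inv_opp; last first.
  exact: is_root_mul.
by ring.
Qed.

Section RootPolynomials.
Variables (act : 'M[int]_n -> K -> K) (op : seq 'I_n -> QW n K).
Variables (tau : K) (eps scale : 'cV[int]_n -> K).
Hypotheses (act_W : act_ok t x act C) (tau_eq : tau = 0 \/ tau = t).
Hypothesis qact_op : forall s f w, W w -> qact act (op s) f w = demazure_word (t - tau) f s w.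
Hypothesis scaleE : forall b, is_root C b -> scale b = 1 - (t - tau) * x (- b).
Hypothesis scale_eps : forall b, is_root C b -> scale b * eps b = x (- b).

Lemma opp_schubert_class_root_poly s v : W v ->
  opp_schubert_class tau v (word s) = (\prod_(b <- betas C s) scale b) * root_poly op eps s v.
Proof.
have tau'_eq : t - tau = 0 \/ t - tau = t.
  by case: tau_eq => ->; [right; rewrite subr0 | left; rewrite subrr].
elim/last_ind: s v => [|s i IH] v Wv.
  by rewrite big_nil mul1r opp_schubert_class1 // (root_poly_nil act_W tau'_eq qact_op).
have Rb : is_root C (word s *m alpha i) by apply: is_root_mul.
rewrite wordmx_rcons opp_schubert_class_mul_sref // !IH // betas_rcons -cats1 big_cat big_seq1 /=.
rewrite (root_poly_rcons act_W tau'_eq qact_op) //.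
by case: ifP => _; rewrite -(scaleE Rb) -?(scale_eps Rb); ring.
Qed.

End RootPolynomials.

Section Duality.
Variable act : 'M[int]_n -> K -> K.
Hypothesis act_W : act_ok t x act C.

Lemma psi_theta_KY v w : W v -> W w ->
  psi x C Wl w0 v w = theta t x C Wl w * KY x act C Wl v w.
Proof.
move=> Wv Ww; rewrite /psi zetaX_schubert_class theta_betas // -{1}(wordmx_rword Ww).
apply: (opp_schubert_class_root_poly act_W) => // [|s f y Wy|b _|b _].
- by left.
- by rewrite subr0; apply: qact_Yword.
- by rewrite subr0 fgl_exp_inv.
by rewrite fgl_exp_inv mulrN mulrBl mul1r mulrAC -fgl_opp opprB addrAC subrr add0r.
Qed.

Lemma xi_KX v w : W v -> W w -> xi x C Wl w0 v w = KX x act C Wl v w.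
Proof.
move=> Wv Ww; have Www0 : W (w *m w0) by [].
transitivity (\prod_(b <- betas C (rword C w)) 1 * KX x act C Wl v w); last first.
  by rewrite big1_eq mul1r.
rewrite /xi zetaY_schubert_class // -{1}(wordmx_rword Ww).
apply: (opp_schubert_class_root_poly act_W) => // [|s f y Wy|b _|b _].
- by right.
- by rewrite subrr; apply: qact_Xword.
- by rewrite subrr mul0r subr0.
by rewrite mul1r.
Qed.

End Duality.
End GKM.
End ConnectiveKTheory.
End FiniteType.
End Cartan.
End WeylGroup.

Theorem theorem5p2 (n : nat) (C : 'M[int]_n) (HC : cartan C)
    (Wl : seq 'M[int]_n) (HW : forall w, inW C w <-> w \in Wl)
    (w0 : 'M[int]_n) (Hw0 : longest C w0)
    (K : comUnitRingType) (t : K) (x : 'cV[int]_n -> K) (act : 'M[int]_n -> K -> K)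
    (Hfgl : fgl_ok t x) (Hact : act_ok t x act C) (Hunit : roots_invertible x C) :
  forall v w : 'M[int]_n, inW C v -> inW C w ->
    psi x C Wl w0 v w = theta t x C Wl w * KY x act C Wl v w
    /\ xi x C Wl w0 v w = KX x act C Wl v w.
Proof.
move=> v w Wv Ww; split.
  exact: (psi_theta_KY HC HW Hfgl Hunit Hw0 Hact).
exact: (xi_KX HC HW Hfgl Hunit Hw0 Hact).
Qed.
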